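(* Fix $k\ge 2$. For every rook placement $P$ on a Ferrers board $F$ one has $$\mathrm{seq}_k(P,F)=\mathrm{seq}(\phi^*(P),F),$$ where $\phi^*$ is the map on rook placements defined with this $k$, $\mathrm{seq}$ is the sequence of border partitions produced by the growth diagram algorithm $GDA$, and $\mathrm{seq}_k$ is the sequence of border partitions produced by the modified algorithm $GDA_k$.
   Context: Boards and placements. In an $n\times n$ array of squares, $(i,j)$ denotes the square in the $i$th column from the left and the $j$th row from the bottom; $R(i,j)$ is the rectangle of all squares $(k',\ell')$ with $k'\le i$, $\ell'\le j$. A Ferrers board is a subset $F$ of such an array such that $(i,j)\in F$ implies $R(i,j)\subseteq F$. A rook placement $P$ on $F$ is a subset of $F$ with at most one square in each row and at most one square in each column (not necessarily full); its squares are said to contain markers. The map $\phi^*$. An occurrence of $k\ldots 1$ (a $k\ldots1$-pattern) in $P$ is a sequence of squares $(i_1,\pi_{1}),\ldots,(i_k,\pi_{k})$ of $P$ with $i_1<\cdots<i_k$ and $\pi_1>\cdots>\pi_k$, all contained in a common rectangular subboard of $F$ (equivalently $(i_k,\pi_1)\in F$). Order the occurrences lexicographically by their row sequences $(\pi_1,\ldots,\pi_k)$. If $P$ has an occurrence of $k\ldots1$, $\phi(P)$ is obtained from $P$ by taking the smallest occurrence and replacing its squares by $(i_1,\pi_2),(i_2,\pi_3),\ldots,(i_{k-1},\pi_k),(i_k,\pi_1)$, leaving all other squares of $P$ unchanged. $\phi^*(P)$ is obtained by applying $\phi$ repeatedly until no occurrence of $k\ldots 1$ remains (so $\phi^*(P)=P$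 if there is none). Growth diagrams. $GDA$ assigns an integer partition to each corner of each square of $F$: corners on the left and bottom edges of $F$ get the empty partition $\emptyset$; if the northwest, southwest and southeast corners of a square have been assigned $NW, SW, SE$, its northeast corner is assigned $NE$ by the rules: (1) if $NW\ne SE$ then $NE=NW\cup SE$ (entrywise maximum, absent entries being $0$); (2) if $SW\ne NW=SE$ then $NW$ is obtained from $SW$ by adding 1 to the $i$th entry for some $i$, and $NE$ is obtained from $NW$ by adding 1 to the $(i+1)$th entry; (3) if $SW=NW=SE$ then $NE=SW$, unless the square contains a marker of $P$, in which case $NE$ is obtained from $SW$ by adding 1 to the first entry. $GDA_k$ is the same, except that rule (2) is replaced by: ($2_k$) apply rule (2), but if this produces an $NE$ with $k$ nonzero entries, then delete the last entry and increase the first entry by 1. The right/up border of $F$ is the border of $F$ minus the horizontal bottom edge and the vertical left edge. $\mathrm{seq}(P,F)$ (respectively $\mathrm{seq}_k(P,F)$) is the sequence of partitions assigned to the corners along the right/up border of $F$, traversed in a fixed direction, when $GDA$ (respectively $GDA_k$) is applied to $P$ and $F$. *)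

(* Defs.v *)
From mathcomp Require Import all_boot all_order zify.

Set Implicit Arguments.
Unset Strict Implicit.
Unset Printing Implicit Defensive.

(* Columns and rows are numbered from 0: the square (i, j) is in column i from
   the left and row j from the bottom. *)
Definition square (n : nat) : finType := ('I_n * 'I_n)%type.

Section Boards.
Variable n : nat.
Implicit Types (x c : square n) (F P : {set square n}).

Definition rectangle c : {set square n} :=
  [set x : square n | (x.1 <= c.1)%N && (x.2 <= c.2)%N].

Definition ferrers F : Prop := forall c, c \in F -> rectangle c \subset F.

Definition rook_placement F P : Prop :=
  [/\ P \subset F, {in P &, injective fst} & {in P &, injective snd}].

End Boards.

Section Phi.
Variables (k n : nat) (F : {set square n}).
Implicit Types (P : {set square n}) (s t : k.-tuple (square n)).

Definition occurrence P s : bool :=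
  [&& all (fun x => x \in P) s,
      sorted (fun x y : square n => (x.1 < y.1)%N && (y.2 < x.2)%N) s
    & [exists c : square n, (rectangle c \subset F)
                            && all (fun x => x \in rectangle c) s]].

Definition has_occurrence P : bool := [exists s, occurrence P s].

(* Lists of this type are compared lexicographically. *)
Definition rows (s : seq (square n)) : seqlexi nat :=
  [seq nat_of_ord x.2 | x <- s].

(* In a rook placement an occurrence is determined by its rows, so there is at
   most one smallest occurrence. *)
Definition smallest_occurrence P : option (k.-tuple (square n)) :=
  [pick s | occurrence P s
            && [forall t, occurrence P t ==> (rows s <= rows t)%O]].

Definition shift_rows (s : seq (square n)) : seq (square n) :=
  zip (map fst s) (rot 1 (map snd s)).

Definition phi P : {set square n} :=
  if smallest_occurrence P is Some s
  then (P :\: [set x in s]) :|: [set x in shift_rows s] else P.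

(* If 2 <= k, each effective application of phi decreases this weight. *)
Definition weight P : nat := \sum_(x in P) (n - x.1) * x.2.

(* phi fixes P as soon as P has no occurrence, and by phi_star_avoids below
   weight P applications are enough to reach that point. *)
Definition phi_star P : {set square n} := iter (weight P) phi P.

Lemma has_smallest P : has_occurrence P -> smallest_occurrence P <> None.
Proof.
case/existsP=> s0 s0P; rewrite /smallest_occurrence; case: pickP => // noP _.
have [s sP smin] := @Order.TotalTheory.arg_minP _ (seqlexi nat) _ s0 _ (fun s => rows s) s0P.
have := noP s; rewrite sP /=; move/negbT/forallP; apply=> t.
by apply/implyP => /smin.
Qed.

Lemma phi_id P : ~~ has_occurrence P -> phi P = P.
Proof.
move=> noP; rewrite /phi /smallest_occurrence; case: pickP => // s /andP[sP _].
by case/existsP: noP; exists s.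
Qed.

Let w (x : square n) := (n - x.1) * x.2.

Lemma shift_rows_weight (s : seq (square n)) :
  1 < size s ->
  sorted (fun x y : square n => (x.1 < y.1)%N && (y.2 < x.2)%N) s ->
  \sum_(x <- shift_rows s) w x < \sum_(x <- s) w x.
Proof.
case: s => [|x [|y s]] //= _; rewrite /shift_rows [map snd _]/= rot1_cons /=.
move=> /andP[/andP[lt1 lt2] srt]; rewrite big_cons /w /=.
suff H (z0 : 'I_n) (y0 : square n) (s0 : seq (square n)) :
    path (fun x y : square n => (x.1 < y.1)%N && (y.2 < x.2)%N) y0 s0 ->
    (y0.2 < z0)%N ->
    \sum_(x <- zip (y0.1 :: map fst s0) (rcons (map snd s0) z0)) w x
      <= \sum_(x <- y0 :: s0) w x + (n - y0.1) * (z0 - y0.2).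
  have := H x.2 y s srt lt2; rewrite !big_cons /w /=.
  have := ltn_ord y.1; have := ltn_ord x.1; move: lt1 lt2.
  move: (nat_of_ord x.1) (nat_of_ord x.2) (nat_of_ord y.1) (nat_of_ord y.2).
  move=> a b c d ac db an cn.
  set S1 := bigop _ _ _; set S2 := bigop _ _ _.
  have [e ->] : exists e, b = d + e.+1 by exists (b - d).-1; lia.
  have [f ->] : exists f, n - a = (n - c) + f.+1 by exists (c - a).-1; lia.
  by rewrite addKn; nia.
elim: s0 y0 => [|y1 s0 IH] y0 /=.
  move=> _ lt0; rewrite !big_cons !big_nil /w /= !addn0 -mulnDr.
  by rewrite leq_mul2l; apply/orP; right; lia.
move=> /andP[/andP[l1 l2] srt0] lt0; rewrite big_cons [X in _ <= X + _]big_cons.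
have := IH y1 srt0 (ltn_trans l2 lt0); rewrite /w /=.
move: l1 l2 lt0 (ltn_ord y1.1).
set S1 := bigop _ _ _; set S2 := bigop _ _ _.
move: (nat_of_ord y0.1) (nat_of_ord y0.2) (nat_of_ord y1.1) (nat_of_ord y1.2).
move: (nat_of_ord z0) => z a b c d ac db bz cn.
have [e ->] : exists e, b = d + e.+1 by exists (b - d).-1; lia.
have [f ->] : exists f, n - a = (n - c) + f.+1 by exists (c - a).-1; lia.
have [g zE] : exists g, z = b + g.+1 by exists (z - b).-1; lia.
by nia.
Qed.

Lemma sum_set_of_seq (T : finType) (f : T -> nat) (r : seq T) :
  \sum_(x in [set x in r]) f x <= \sum_(x <- r) f x.
Proof.
elim: r => [|x r IH]; first by rewrite big_nil big1 // => i; rewrite inE.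
rewrite set_cons big_cons; case: (boolP (x \in [set y in r])) => xr.
  by rewrite (setUidPr _) ?sub1set //; exact: leq_trans IH (leq_addl _ _).
by rewrite big_setU1 //= leq_add2l.
Qed.

Lemma phi_weight P : 1 < k -> has_occurrence P -> weight (phi P) < weight P.
Proof.
move=> k2 /has_smallest; rewrite /phi; case E: smallest_occurrence => [s|] // _.
move: E; rewrite /smallest_occurrence; case: pickP => // t /andP[tP _] [<-] {s}.
case/and3P: tP => /allP tP srt _.
have sub : [set x in t] \subset P by apply/subsetP=> x; rewrite inE => /tP.
have ut : uniq t.
  apply: (sorted_uniq (leT := fun x y : square n => (x.1 < y.1)%N && (y.2 < x.2)%N)) => //.
    by move=> y x z /andP[? ?] /andP[? ?]; apply/andP; split; lia.
  by move=> x; rewrite ltnn.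
have lt := shift_rows_weight (s := t) ltac:(by rewrite size_tuple) srt.
rewrite /weight -/w [X in _ < X](big_setID [set x in t]) /=.
rewrite (setIidPr sub) [X in _ < X]addnC.
have -> : \sum_(x in [set x in t]) w x = \sum_(x <- t) w x.
  by rewrite big_uniq //; apply: eq_bigl => x; rewrite inE.
apply: leq_ltn_trans (_ : \sum_(x in P :\: [set x in t]) w x
         + \sum_(x <- shift_rows t) w x < _); last by rewrite ltn_add2l.
rewrite (big_setID (P :\: [set x in t])) /= setUK setDUl setDv set0U.
rewrite leq_add2l; apply: leq_trans (sum_set_of_seq w _).
rewrite [X in _ <= X](big_setID (P :\: [set x in t])) /=; exact: leq_addl.
Qed.

Lemma phi_star_avoids P : 1 < k -> ~~ has_occurrence (phi_star P).
Proof.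
move=> k2; rewrite /phi_star.
have H m Q : weight Q <= m -> ~~ has_occurrence (iter m phi Q).
  elim: m Q => [|m IH] Q; case: (boolP (has_occurrence Q)) => oQ leQ //=.
  - by have := phi_weight k2 oQ; lia.
  - rewrite -iterS iterSr; apply: IH; have := phi_weight k2 oQ; lia.
  - have fixQ j : iter j phi Q = Q by elim: j => //= j ->; exact: phi_id.
    by rewrite fixQ phi_id.
exact: H.
Qed.

End Phi.

(* Partitions are lists of entries, in weakly decreasing order and without
   trailing zeros; positions are counted from 0. *)
Definition partition_union (s t : seq nat) : seq nat :=
  mkseq (fun i => maxn (nth 0 s i) (nth 0 t i)) (maxn (size s) (size t)).

(* Used only where nw is sw with one entry increased by 1: i is the position of
   that entry, and the next entry is the one to be increased. *)
Definition rule2 (sw nw : seq nat) : seq nat :=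
  let i := find (fun i => nth 0 sw i != nth 0 nw i) (iota 0 (size nw)) in
  incr_nth nw i.+1.

Definition rule2k (k : nat) (sw nw : seq nat) : seq nat :=
  let ne := rule2 sw nw in
  if count (fun m => m != 0) ne == k
  then incr_nth (take (size ne).-1 ne) 0 else ne.

Definition northeast (r2 : seq nat -> seq nat -> seq nat) (marker : bool)
    (sw nw se : seq nat) : seq nat :=
  if nw != se then partition_union nw se
  else if sw != nw then r2 sw nw
  else if marker then incr_nth sw 0 else sw.

Section Growth.
Variables (n : nat).
Implicit Types (A F P : {set square n}).

Definition has_square A (a b : nat) : bool :=
  [exists x in A, (x.1 == a :> nat) && (x.2 == b :> nat)].

(* The corner (a, b) is the southwest corner of the square (a, b). Labels
   propagate from the southwest only, so those of the corners of a Ferrers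
   board F do not depend on the squares outside F, and F is not an argument. *)
Fixpoint growth (r2 : seq nat -> seq nat -> seq nat) P (a : nat) :
    nat -> seq nat :=
  fix column (b : nat) : seq nat :=
    match a, b with
    | a'.+1, b'.+1 => northeast r2 (has_square P a' b')
                        (growth r2 P a' b') (growth r2 P a' b) (column b')
    | _, _ => [::]
    end.

Lemma growth0l r2 P b : growth r2 P 0 b = [::].
Proof. by case: b. Qed.

Lemma growth0r r2 P a : growth r2 P a 0 = [::].
Proof. by case: a. Qed.

Lemma growthS r2 P a b :
  growth r2 P a.+1 b.+1 =
  northeast r2 (has_square P a b)
    (growth r2 P a b) (growth r2 P a b.+1) (growth r2 P a.+1 b).
Proof. by []. Qed.

Definition corner_of F (a b : nat) : bool :=
  [exists x in F, ((a == x.1) || (a == x.1.+1)) && ((b == x.2) || (b == x.2.+1))].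

(* A corner of F lies on the right/up border when the square to its northeast
   is not in F. *)
Definition on_border F (a b : nat) : bool :=
  corner_of F a b && ~~ has_square F a b.

(* The right/up border, from its top left end to its bottom right end. *)
Definition border F : seq (nat * nat) :=
  [seq c <- [seq (a, b) | a <- iota 0 n.+1, b <- rev (iota 0 n.+1)]
     | on_border F c.1 c.2].

Definition border_seq P F : seq (seq nat) :=
  [seq growth rule2 P c.1 c.2 | c <- border F].

Definition border_seqk (k : nat) P F : seq (seq nat) :=
  [seq growth (rule2k k) P c.1 c.2 | c <- border F].

End Growth.

(* Main.v *)
Require Import Defs.
From mathcomp Require Import all_boot all_order zify.

(* The first entry of the label of a corner is the length of the longest
   increasing chain of markers southwest of it, and the remaining entries form the
   label of the same corner for Viennot's skeleton of the placement (the markers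
   created by rule 2).  A decreasing chain of k-1 skeleton markers lifts to a
   decreasing chain of k markers with the same top row and the same last column;
   hence no label has k entries when there is no occurrence, and then GDA_k and
   GDA agree.

   It remains to see that phi does not change the labels that GDA_k puts on the
   border.  The lexicographically smallest occurrence is the most southwestern
   chain of length k in the rectangle that it spans, and this rectangle contains
   no longer chain.  Moving its markers to the inner southwest corners of the
   chain raises the longest increasing chains by one in a union of disjoint
   rectangles, and this moves the markers of a most southwestern chain of length
   k-1 of the skeleton in the same way.  By induction on k, the labels on the top
   and right sides of the rectangle correspond, up to one box which enters only at
   the corner, in the first entry for both placements. *)

Set Implicit Arguments.
Unset Strict Implicit.
Unset Printing Implicit Defensive.

(** * Heights and skeletons *)

Definition grid := nat -> nat -> bool.

Definition placement (m : grid) : Prop :=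
  (forall a b b', m a b -> m a b' -> b = b') /\
  (forall a a' b, m a b -> m a' b -> a = a').

(* Length of the longest increasing chain of markers southwest of a corner. *)
Fixpoint height (m : grid) (a : nat) : nat -> nat :=
  fix column (b : nat) : nat :=
    match a, b with
    | a'.+1, b'.+1 =>
        maxn (maxn (height m a' b) (column b')) (height m a' b' + m a' b')
    | _, _ => 0
    end.

(* Exactly one unit is added across each of the left and bottom edges of the
   square, so these are the squares where rule 2 increases the second entry. *)
Definition skel (m : grid) : grid := fun a b =>
  (height m a b < height m a.+1 b) && (height m a b < height m a b.+1).

Definition transpose (m : grid) : grid := fun a b => m b a.

Lemma height0l m b : height m 0 b = 0. Proof. by case: b. Qed.
Lemma height0r m a : height m a 0 = 0. Proof. by case: a. Qed.
Lemma heightS m a b : height m a.+1 b.+1 =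
  maxn (maxn (height m a b.+1) (height m a.+1 b)) (height m a b + m a b).
Proof. by []. Qed.

Lemma height_tr (m : grid) a b : height (transpose m) b a = height m a b.
Proof.
elim: a b => [|a IHa] b; first by rewrite height0l height0r.
elim: b => [|b IHb]; first by rewrite height0l height0r.
by rewrite !heightS !IHa IHb [maxn (height m a.+1 b) _]maxnC.
Qed.

Lemma skel_tr (m : grid) a b : skel (transpose m) b a = skel m a b.
Proof. by rewrite /skel !(height_tr m) andbC. Qed.

Lemma placement_tr (m : grid) : placement m -> placement (transpose m).
Proof.
by case=> h1 h2; split=> a b c hb hc; [exact: h2 hb hc | exact: h1 hb hc].
Qed.

Lemma height_leSl m a b : height m a b <= height m a.+1 b.
Proof. by case: b => [|b]; rewrite ?height0r // heightS; lia. Qed.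

Lemma height_leSr m a b : height m a b <= height m a b.+1.
Proof. by case: a => [|a]; rewrite ?height0l // heightS; lia. Qed.

Lemma height_mono (m : grid) a a' b b' :
  a <= a' -> b <= b' -> height m a b <= height m a' b'.
Proof.
move=> /subnKC <- /subnKC <-; elim: (a' - a) => [|i IH].
  rewrite addn0; elim: (b' - b) => [|j IH]; first by rewrite addn0.
  by rewrite addnS; apply: leq_trans IH (height_leSr _ _ _).
by rewrite addnS; apply: leq_trans IH (height_leSl _ _ _).
Qed.

Lemma height_marker (m : grid) a b : m a b -> height m a b < height m a.+1 b.+1.
Proof. by rewrite heightS => ->; lia. Qed.

Lemma height_marker_lt (m : grid) x y a b : m x y -> x < a -> y < b ->
  height m x y < height m a b.
Proof. by move=> /height_marker h xa yb; apply: leq_trans h (height_mono _ xa yb). Qed.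

Lemma height_stepr (m : grid) a b : height m a b.+1 <= (height m a b).+1.
Proof.
elim: a => [|a IH]; first by rewrite height0l.
by rewrite heightS; have := height_leSl m a b; case: (m a b); lia.
Qed.

Lemma height_stepl (m : grid) a b : height m a.+1 b <= (height m a b).+1.
Proof. by rewrite -!(height_tr m) height_stepr. Qed.

Lemma height_row0 (m : grid) a b : (forall x, x < a -> ~~ m x b) ->
  height m a b.+1 = height m a b.
Proof.
elim: a => [|a IH] no; first by rewrite !height0l.
rewrite heightS (IH _) => [|x xa]; last by apply: no; lia.
by have := height_leSl m a b; rewrite (negbTE (no a _)) //; lia.
Qed.

Lemma height_col0 (m : grid) a b : (forall y, y < b -> ~~ m a y) ->
  height m a.+1 b = height m a b.
Proof. by move=> no; rewrite -!(height_tr m) height_row0. Qed.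

(** Along a longest chain southwest of the corner the heights at the markers run through 0, 1, 2 and
    so on, so every smaller value occurs. *)
Lemma height_gt (m : grid) a b p : p < height m a b ->
  exists x y, [/\ x < a, y < b, m x y & height m x y = p].
Proof.
elim: a b => [|a IHa] b; first by rewrite height0l.
elim: b => [|b IHb]; first by rewrite height0r.
rewrite heightS => lt.
have [/IHa[x [y [? ? ? ?]]]|ge1] := ltnP p (height m a b.+1).
  by exists x, y; split=> //; lia.
have [/IHb[x [y [? ? ? ?]]]|ge2] := ltnP p (height m a.+1 b).
  by exists x, y; split=> //; lia.
have le := height_leSr m a b.
by exists a, b; split=> //; move: lt; case: (m a b) => //; lia.
Qed.

Lemma placement_row (m : grid) a b : placement m -> m a b -> height m a b.+1 = height m a b.
Proof.
case=> _ h mab; apply: height_row0 => x xa; apply/negP => mxb.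
by have := h _ _ _ mab mxb; lia.
Qed.

Lemma placement_col (m : grid) a b : placement m -> m a b -> height m a.+1 b = height m a b.
Proof.
case=> h _ mab; apply: height_col0 => x xa; apply/negP => mxb.
by have := h _ _ _ mab mxb; lia.
Qed.

Lemma placement_ne (m : grid) a b : placement m -> m a b ->
  height m a.+1 b.+1 = (height m a b).+1.
Proof.
by move=> pm mab; rewrite heightS placement_row // placement_col // mab; lia.
Qed.

(** The step across row b comes from a marker of height [height m a b]; strictly below row b such a
    marker would already make [height m a b] larger. *)
Lemma skel_row (m : grid) a b : skel m a b ->
  exists x, [/\ x < a, m x b & height m x b = height m a b].
Proof.
case/andP=> _ /height_gt[x [y [xa yb mxy e]]]; exists x.
suff yE : y = b by subst y.
apply/eqP; rewrite eqn_leq -ltnS yb /= leqNgt; apply/negP => ltb.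
by have := height_marker_lt mxy xa ltb; lia.
Qed.

Lemma skel_col (m : grid) a b : skel m a b ->
  exists y, [/\ y < b, m a y & height m a y = height m a b].
Proof.
rewrite -(skel_tr m) => /skel_row[y [yb may e]]; exists y; split=> //.
by move: e; rewrite !(height_tr m).
Qed.

Definition row_marker (m : grid) a b := has (m ^~ b) (iota 0 a).

Lemma row_markerP (m : grid) a b : reflect (exists2 x, x < a & m x b) (row_marker m a b).
Proof.
apply: (iffP hasP) => -[x]; first by rewrite mem_iota => ? ?; exists x; lia.
by move=> ? ?; exists x => //; rewrite mem_iota; lia.
Qed.

Lemma row_markerS (m : grid) a b : row_marker m a.+1 b = row_marker m a b || m a b.
Proof. by rewrite /row_marker -addn1 iotaD has_cat /= orbF. Qed.

Lemma row_marker_skel (m : grid) a b : row_marker (skel m) a b -> row_marker m a b.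
Proof.
case/row_markerP=> x xa /skel_row[y [yx myb _]].
by apply/row_markerP; exists y => //; lia.
Qed.

(** Going right along row b, the difference between the two sides of the row becomes 1 at the marker
    and drops back to 0 at the skeleton marker. *)
Lemma height_row_edge m a b : placement m -> height m a b.+1 =
  height m a b + (row_marker m a b && ~~ row_marker (skel m) a b).
Proof.
move=> pm; elim: a => [|a IH]; first by rewrite !height0l.
rewrite !row_markerS.
have [mab|nmab] := boolP (m a b).
  have nr : ~~ row_marker m a b.
    apply/negP => /row_markerP[x xa mxb].
    by case: pm => _ h; have := h _ _ _ mab mxb; lia.
  have ns : ~~ row_marker (skel m) a b by apply: contra nr; apply: row_marker_skel.
  rewrite orbT (negbTE ns) placement_ne // placement_col // /skel.
  by rewrite placement_col // ltnn /=; lia.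
rewrite heightS (negbTE nmab) addn0 orbF negb_or /skel IH.
have := height_leSl m a b; have := height_stepl m a b.
by case: (row_marker m a b); case: (row_marker (skel m) a b) => /=; lia.
Qed.

(** A second skeleton marker in a row would need a step across the row that has ended at the first
    one. Columns follow by transposition. *)
Lemma skel_placement (m : grid) : placement m -> placement (skel m).
Proof.
have rowinj (m' : grid) a a' b : placement m' -> skel m' a b -> skel m' a' b -> a' <= a.
  move=> pm s s'; rewrite leqNgt; apply/negP => aa'.
  have rs : row_marker (skel m') a' b by apply/row_markerP; exists a.
  by case/andP: s'; rewrite height_row_edge // rs andbF addn0 ltnn.
move=> pm; split=> [a b b' s s' | a a' b s s'].
  by apply/eqP; rewrite eqn_leq; apply/andP; split;
    apply: (rowinj (transpose m) _ _ a); rewrite ?(skel_tr m) //; apply: placement_tr.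
by apply/eqP; rewrite eqn_leq; apply/andP; split; apply: (rowinj m _ _ b).
Qed.

Lemma height_agree (m m' : grid) w r :
  (forall a b, a < w -> b < r -> m a b = m' a b) ->
  forall a b, a <= w -> b <= r -> height m a b = height m' a b.
Proof.
move=> e; elim=> [|a IHa] b aw; first by rewrite !height0l.
elim: b => [|b IHb] br; first by rewrite !height0r.
by rewrite !heightS !IHa ?IHb ?e //; lia.
Qed.

Lemma skel_agree (m m' : grid) w r :
  (forall a b, a < w -> b < r -> m a b = m' a b) ->
  forall a b, a < w -> b < r -> skel m a b = skel m' a b.
Proof.
move=> e a b aw br; rewrite /skel.
by rewrite !(height_agree e) //; lia.
Qed.

(** The heights of [level m i] turn out to be the entries at position i of the growth labels. *)
Definition level (m : grid) i : grid := iter i skel m.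

Lemma levelSr (m : grid) i : level m i.+1 = level (skel m) i.
Proof. exact: iterSr. Qed.

Lemma level_placement (m : grid) i : placement m -> placement (level m i).
Proof. by move=> pm; elim: i => //= i; apply: skel_placement. Qed.

Lemma level_agree (m m' : grid) w r i :
  (forall a b, a < w -> b < r -> m a b = m' a b) ->
  forall a b, a <= w -> b <= r -> height (level m i) a b = height (level m' i) a b.
Proof.
elim: i m m' => [|i IH] m m' e; first exact: height_agree.
by rewrite !levelSr; apply: IH; apply: skel_agree.
Qed.

Lemma row_marker_level (m : grid) i j a b : i <= j ->
  row_marker (level m j) a b -> row_marker (level m i) a b.
Proof.
by move=> /subnKC <-; elim: (j - i) => [|d IH]; rewrite ?addn0 // addnS => /row_marker_skel.
Qed.

(** * Decreasing chains *)

(** Functions instead of lists make inserting, replacing and splicing markers a matter of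
    conditionals; only arguments below k count. *)
Definition chain (m : grid) k (C R : nat -> nat) : Prop :=
  (forall j, j < k -> m (C j) (R j)) /\
  (forall j, j.+1 < k -> C j < C j.+1 /\ R j.+1 < R j).

Lemma chain_lt (m : grid) k C R i j : chain m k C R -> i < j -> j < k ->
  C i < C j /\ R j < R i.
Proof.
case=> _ step /subnKC <-; elim: (j - i.+1) => [|d IH].
  by rewrite addn0; apply: step.
rewrite addnS => lt; have [? ?] := step _ lt.
by have [|? ?] := IH; lia.
Qed.

Lemma chain_le (m : grid) k C R i j : chain m k C R -> i <= j -> j < k ->
  C i <= C j /\ R j <= R i.
Proof.
move=> ch; rewrite leq_eqVlt => /predU1P[-> //|lt] jk.
by have [] := chain_lt ch lt jk; lia.
Qed.

Lemma chain_col_inj (m : grid) k C R i j : chain m k C R -> i < k -> j < k ->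
  C i = C j -> i = j.
Proof.
move=> ch ik jk e; case: (ltngtP i j) => // lt.
  by have [] := chain_lt ch lt jk; lia.
by have [] := chain_lt ch lt ik; lia.
Qed.

Lemma chain_row_inj (m : grid) k C R i j : chain m k C R -> i < k -> j < k ->
  R i = R j -> i = j.
Proof.
move=> ch ik jk e; case: (ltngtP i j) => // lt.
  by have [] := chain_lt ch lt jk; lia.
by have [] := chain_lt ch lt ik; lia.
Qed.

Lemma chain_insert (m : grid) k C R i x y : chain m k C R -> i <= k -> m x y ->
  (0 < i -> C i.-1 < x /\ y < R i.-1) -> (i < k -> x < C i /\ R i < y) ->
  chain m k.+1 (fun j => if j < i then C j else if j == i then x else C j.-1)
               (fun j => if j < i then R j else if j == i then y else R j.-1).
Proof.
case=> pts step ik mxy lo hi; split=> j jk.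
  case: (ltngtP j i) => ji //; first by apply: pts; lia.
  by apply: pts; lia.
case: (ltngtP j i) => ji; case: (ltngtP j.+1 i) => ji' //=; try lia.
- by apply: step; lia.
- by move: lo; rewrite -ji' /=; apply.
- by have := step j.-1; rewrite prednK; [apply; lia | lia].
- by rewrite ji; apply: hi; lia.
Qed.

Lemma chain_replace (m : grid) k C R i x y : chain m k C R -> i < k -> m x y ->
  (0 < i -> C i.-1 < x /\ y < R i.-1) -> (i.+1 < k -> x < C i.+1 /\ R i.+1 < y) ->
  chain m k (fun j => if j == i then x else C j) (fun j => if j == i then y else R j).
Proof.
case=> pts step ik mxy lo hi; split=> j jk.
  by case: (ltngtP j i) => ji //; apply: pts; lia.
case: (ltngtP j i) => ji; case: (ltngtP j.+1 i) => ji' //=; try lia.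
- by apply: step; lia.
- by move: lo; rewrite -ji' /=; apply.
- by apply: step; lia.
- by move: hi jk; rewrite -ji /= => hi jk; apply: hi.
Qed.

(** The exchange argument: when no chain has length k+1, the j-th markers of two chains of length k
    are never strictly northwest and southeast of each other. *)
Lemma chain_splice (m : grid) k C R C' R' j : chain m k C R -> chain m k C' R' ->
  j < k -> C j < C' j -> R' j < R j ->
  chain m k.+1 (fun i => if i <= j then C i else C' i.-1)
               (fun i => if i <= j then R i else R' i.-1).
Proof.
move=> ch ch' jk lt1 lt2; split=> i ik.
  by case: leqP => ij; [apply: ch.1 | apply: ch'.1]; lia.
case: (leqP i j) => ij; case: (leqP i.+1 j) => ij' /=; try lia.
- by apply: ch.2; lia.
- by have -> : i = j by lia.
- by have := ch'.2 i.-1; rewrite prednK; [apply; lia | lia].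
Qed.

Definition left_marker (m : grid) a b := find (m ^~ b) (iota 0 a).
Definition down_marker (m : grid) a b := find (m a) (iota 0 b).

Lemma left_markerP (m : grid) a b : placement m -> skel m a b ->
  let x := left_marker m a b in
  [/\ x < a, m x b & height m x b = height m a b].
Proof.
move=> pm /skel_row[x [xa mxb e]].
have : has (m ^~ b) (iota 0 a) by apply/row_markerP; exists x.
move=> hs; have lt : left_marker m a b < a.
  by move: hs; rewrite has_find size_iota.
have := nth_find 0 hs; rewrite nth_iota // add0n => mfx /=.
by rewrite -[find _ _]/(left_marker m a b) in mfx; rewrite (pm.2 _ _ _ mfx mxb).
Qed.

Lemma down_markerP (m : grid) a b : placement m -> skel m a b ->
  let y := down_marker m a b in
  [/\ y < b, m a y & height m a y = height m a b].
Proof.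
move=> pm s; have := @left_markerP (transpose m) b a (placement_tr pm).
by rewrite (skel_tr m) /= !(height_tr m) => /(_ s).
Qed.

(** * Lifting chains from the skeleton *)

Definition height_at (m : grid) (A B : nat -> nat) j := height m (A j) (B j).

Section Lift.
Variables (m : grid) (k : nat) (A B : nat -> nat).
Hypotheses (pm : placement m) (k0 : 0 < k) (chAB : chain (skel m) k A B).

Local Notation hgt := (height_at m A B).

(** The j-th lifted marker lies between the skeleton markers j-1 and j: it is the one below the
    former or the one left of the latter, whichever has the larger height, the former in a tie. At
    both ends only one candidate exists. *)
Definition lift_down j := (0 < j) && ((j == k) || (hgt j <= hgt j.-1)).
Definition lift_col j :=
  if lift_down j then A j.-1 else left_marker m (A j) (B j).
Definition lift_row j :=
  if lift_down j then down_marker m (A j.-1) (B j.-1) else B j.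

(* A skeleton marker sits northeast of two consecutive markers of equal height;
   neighbouring skeleton markers share the one on the lower contour. *)
Lemma chain_lift : chain m k.+1 lift_col lift_row.
Proof.
have L j : j < k -> let x := left_marker m (A j) (B j) in
    [/\ x < A j, m x (B j) & height m x (B j) = hgt j].
  by move=> jk; apply: left_markerP => //; apply: chAB.1.
have D j : j < k -> let y := down_marker m (A j) (B j) in
    [/\ y < B j, m (A j) y & height m (A j) y = hgt j].
  by move=> jk; apply: down_markerP => //; apply: chAB.1.
split=> j jk; rewrite /lift_col /lift_row.
  case: ifP => [/andP[j0 _]|ldF]; first by case: (D j.-1); lia.
  have jk' : j < k.
    rewrite ltn_neqAle -ltnS jk andbT; apply: contraFneq ldF => ->.
    by rewrite /lift_down eqxx k0.
  by case: (L j).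
(* Except when both markers belong to the same skeleton marker, a wrong order would put one of them
   southwest of the other or of the skeleton marker j. The resulting height inequality contradicts
   the choice made; ties are excluded by the placement. *)
case: (boolP (lift_down j)) => [/andP[j0 ld]|nld];
  case: (boolP (lift_down j.+1)) => [/= /orP ld'|/= nld'].
- have [? mv hv] := D j.-1 ltac:(lia); have [? mv' hv'] := D j jk.
  have [lt1 lt2] := chAB.2 j.-1 ltac:(lia); rewrite prednK // in lt1 lt2.
  split=> //; rewrite ltnNge leq_eqVlt; apply/negP => /predU1P[e|lt].
    by rewrite -e in mv'; have := pm.2 _ _ _ mv mv'; lia.
  have := height_marker_lt mv lt1 lt; rewrite hv hv'.
  have jk' : (j == k) = false by lia.
  by move: ld; rewrite jk' /=; lia.
- have jk' : j.+1 < k by move: nld'; rewrite negb_or; lia.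
  have [? mv hv] := D j.-1 ltac:(lia); have [? mu hu] := L j.+1 jk'.
  have [lt1 lt2] := chAB.2 j.-1 ltac:(lia); rewrite prednK // in lt1 lt2.
  have [lt3 lt4] := chAB.2 j jk'.
  have h1 : hgt j <= hgt j.-1 by move: ld; have /negbTE -> : j != k by lia.
  have h2 : hgt j < hgt j.+1 by move: nld'; rewrite negb_or /=; lia.
  split; rewrite ltnNge; apply/negP => le.
    have := @height_marker_lt _ _ _ (A j) (B j) mu ltac:(lia) lt4.
    by rewrite hu -/(hgt j); lia.
  have := @height_marker_lt _ _ _ (A j) (B j) mv lt1 ltac:(lia).
  by rewrite hv -/(hgt j); lia.
- by have [? _ _] := D j jk; have [? _ _] := L j jk.
- have jk' : j.+1 < k by move: nld'; rewrite negb_or; lia.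
  have [? mu hu] := L j jk; have [? mu' hu'] := L j.+1 jk'.
  have [lt1 lt2] := chAB.2 j jk'.
  split=> //; rewrite ltnNge leq_eqVlt; apply/negP => /predU1P[e|lt].
    by rewrite e in mu'; have := pm.1 _ _ _ mu mu'; lia.
  have := height_marker_lt mu' lt lt2; rewrite hu hu'.
  by move: nld'; rewrite negb_or /=; lia.
Qed.

Lemma lift_row0 : lift_row 0 = B 0.
Proof. by []. Qed.

Lemma lift_col_last : lift_col k = A k.-1.
Proof. by rewrite /lift_col /lift_down k0 eqxx. Qed.

End Lift.

(** Each descent by one level adds a marker and keeps the top row and the last column. *)
Lemma chain_of_level (m : grid) i a b : placement m -> level m i a b ->
  exists C R, [/\ chain m i.+1 C R, C i = a & R 0 = b].
Proof.
move=> pm lab.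
have H j : j <= i ->
    exists C R, [/\ chain (level m (i - j)) j.+1 C R, C j = a & R 0 = b].
  elim: j => [|j IH] ji.
    by rewrite subn0; exists (fun=> a), (fun=> b); split=> //.
  have [C [R [ch Ca Rb]]] := IH (ltnW ji).
  have e : i - j = (i - j.+1).+1 by lia.
  rewrite e in ch; have pl := level_placement (i - j.+1) pm.
  have := chain_lift pl (ltn0Sn j) ch => chl.
  exists (lift_col (level m (i - j.+1)) j.+1 C R).
  exists (lift_row (level m (i - j.+1)) j.+1 C R).
  by split; [exact: chl | rewrite lift_col_last | rewrite lift_row0].
by have := H i (leqnn i); rewrite subnn.
Qed.

(** * Shifting a corner chain *)

Lemma find_iota (p : pred nat) n :
  [/\ find p (iota 0 n) <= n, forall i, i < find p (iota 0 n) -> ~~ p i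
    & find p (iota 0 n) < n -> p (find p (iota 0 n))].
Proof.
have le : find p (iota 0 n) <= n by rewrite -{2}(size_iota 0 n) find_size.
split=> // [i lt | lt].
  by have := before_find 0 lt; rewrite nth_iota ?(leq_trans lt) // add0n => ->.
have := @nth_find _ 0 p (iota 0 n); rewrite nth_iota // has_find size_iota add0n.
exact.
Qed.

(* C lists the columns of a decreasing chain from left to right, R its rows from
   top to bottom; the chain is the most southwestern one of maximal length. *)
Record corner_chain (m : grid) k (C R : nat -> nat) : Prop := CornerChain {
  cc_placement : placement m;
  cc_bound : forall a b, m a b -> a <= C k.-1 /\ b <= R 0;
  cc_chain : chain m k C R;
  cc_max : forall C' R', ~ chain m k.+1 C' R';
  cc_min : forall C' R', chain m k C' R' ->
    forall j, j < k -> C j <= C' j /\ R j <= R' j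
}.

(** The effect of [phi] on the rectangle, without the marker put at its northeast square
    [(C k.-1, R 0)]. *)
Definition shifted (m : grid) k (C R : nat -> nat) : grid := fun a b =>
  (m a b && ~~ has (fun j => (a == C j) && (b == R j)) (iota 0 k))
  || has (fun j => (a == C j) && (b == R j.+1)) (iota 0 k.-1).

Lemma has_iotaP (p : pred nat) n : reflect (exists2 j, j < n & p j) (has p (iota 0 n)).
Proof.
by apply: (iffP hasP) => -[j]; rewrite ?mem_iota => *; exists j;
  rewrite ?mem_iota //; lia.
Qed.

Section Shift.
Variables (m : grid) (k : nat) (C R : nat -> nat).
Hypothesis cc : corner_chain m k C R.

Let pm := cc_placement cc.
Let ch := cc_chain cc.

Definition base_height j := height m (C j) (R j.+1).

(* (next_col j, next_row j) is the j-th marker of the chain of the skeleton along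
   which the skeleton is shifted. *)
Definition next_col j :=
  find (fun a => base_height j < height m a.+1 (R j.+1).+1) (iota 0 (C j.+1)).
Definition next_row j :=
  find (fun b => base_height j < height m (C j).+1 b.+1) (iota 0 (R j)).

Local Notation rho := base_height.
Local Notation A := next_col.
Local Notation B := next_row.

Lemma corner_col j y : j < k -> m (C j) y -> y = R j.
Proof. by move=> jk my; apply: pm.1 my (ch.1 _ jk). Qed.

Lemma corner_row j x : j < k -> m x (R j) -> x = C j.
Proof. by move=> jk my; apply: pm.2 my (ch.1 _ jk). Qed.

Lemma next_col_bounds j : j.+1 < k -> C j < A j /\ A j <= C j.+1.
Proof.
move=> jk; have [le lo hi] := find_iota
  (fun a => rho j < height m a.+1 (R j.+1).+1) (C j.+1).
have [lt1 lt2] := ch.2 j jk; split=> //; rewrite ltnNge; apply/negP => le'.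
(* The marker of column [C j] is higher up and that of row [R j.+1] further right, so stepping over
   this square leaves the height unchanged. *)
have e : height m (C j).+1 (R j.+1).+1 = rho j.
  rewrite height_col0 => [|y yR].
    apply: height_row0 => x xC; apply/negP => /corner_row.
    by move=> /(_ jk); lia.
  by apply/negP => /corner_col; move=> /(_ (ltnW jk)); lia.
have := hi ltac:(rewrite -/(A j); lia); rewrite -/(A j).
by have := @height_mono m (A j).+1 (C j).+1 (R j.+1).+1 _ le' (leqnn _); lia.
Qed.

Lemma next_row_bounds j : j.+1 < k -> R j.+1 < B j /\ B j <= R j.
Proof.
move=> jk; have [le lo hi] := find_iota
  (fun b => rho j < height m (C j).+1 b.+1) (R j).
have [lt1 lt2] := ch.2 j jk; split=> //; rewrite ltnNge; apply/negP => le'.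
have e : height m (C j).+1 (R j.+1).+1 = rho j.
  rewrite height_col0 => [|y yR].
    apply: height_row0 => x xC; apply/negP => /corner_row.
    by move=> /(_ jk); lia.
  by apply/negP => /corner_col; move=> /(_ (ltnW jk)); lia.
have := hi ltac:(rewrite -/(B j); lia); rewrite -/(B j).
by have := @height_mono m (C j).+1 _ (B j).+1 (R j.+1).+1 (leqnn _) le'; lia.
Qed.

Lemma next_col_le j a : j.+1 < k -> a <= A j -> height m a (R j.+1).+1 <= rho j.
Proof.
move=> jk; case: a => [|a] le; first by rewrite height0l.
have [_ lo _] := find_iota (fun a => rho j < height m a.+1 (R j.+1).+1) (C j.+1).
by rewrite leqNgt; apply: lo.
Qed.

Lemma next_row_le j b : j.+1 < k -> b <= B j -> height m (C j).+1 b <= rho j.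
Proof.
move=> jk; case: b => [|b] le; first by rewrite height0r.
have [_ lo _] := find_iota (fun b => rho j < height m (C j).+1 b.+1) (R j).
by rewrite leqNgt; apply: lo.
Qed.

Lemma next_col_gt j : j.+1 < k -> rho j < height m (A j).+1 (R j.+1).+1.
Proof.
move=> jk; have [le _ hi] := find_iota
  (fun a => rho j < height m a.+1 (R j.+1).+1) (C j.+1).
rewrite -/(A j) leq_eqVlt in le; case/predU1P: le => [e|//].
rewrite e placement_ne //; last by apply: ch.1.
by rewrite ltnS height_mono // ltnW //; case: (ch.2 j jk).
Qed.

Lemma next_row_gt j : j.+1 < k -> rho j < height m (C j).+1 (B j).+1.
Proof.
move=> jk; have [le _ hi] := find_iota
  (fun b => rho j < height m (C j).+1 b.+1) (R j).
rewrite -/(B j) leq_eqVlt in le; case/predU1P: le => [e|//].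
rewrite e placement_ne //; last by apply: ch.1; lia.
by rewrite ltnS height_mono // ltnW //; case: (ch.2 j jk).
Qed.

Lemma corner_gap j x y : j.+1 < k -> m x y ->
  C j < x -> x < C j.+1 -> R j.+1 < y -> y < R j -> False.
Proof.
move=> jk mxy *; apply: (cc_max cc); apply: (chain_insert (i := j.+1) ch _ mxy) => //.
exact: ltnW.
Qed.

Lemma corner_low i x y : i < k -> m x y ->
  (0 < i -> C i.-1 < x /\ y < R i.-1) -> (i.+1 < k -> x < C i.+1 /\ R i.+1 < y) ->
  C i <= x /\ R i <= y.
Proof.
move=> ik mxy lo hi.
by have := cc_min cc (chain_replace ch ik mxy lo hi) ik; rewrite /= eqxx.
Qed.

(** Otherwise some marker of height [rho 0] lies left of column [C 0] and between rows [R 1] and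
    [R 0]; replacing the first marker by it contradicts minimality. [next_col_last] is the same at
    the other end. *)
Lemma next_row0 : 1 < k -> B 0 = R 0.
Proof.
move=> k2.
have [lo hi] := @next_row_bounds 0 k2; apply/eqP; rewrite eqn_leq hi leqNgt.
apply/negP => lt; have := next_row_gt k2.
rewrite height_col0 => [/height_gt[x [y [xC yB mxy e]]]|y yB]; last first.
  by apply/negP => /corner_col; move=> /(_ (ltnW k2)); lia.
have [yR|yR|yR] := ltngtP y (R 1).
- by have := height_marker_lt mxy xC yR; rewrite e ltnn.
- have lt1 := ch.2 0 k2; have [] := @corner_low 0 x y ltac:(lia) mxy; lia.
- by rewrite yR in mxy; have := corner_row k2 mxy; have := ch.2 0 k2; lia.
Qed.

Lemma next_col_last : 1 < k -> A k.-2 = C k.-1.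
Proof.
move=> k2.
have [i e] : exists i, k = i.+2 by exists k.-2; lia.
have jk : i.+1 < k by lia.
rewrite e /=.
have [lo hi] := next_col_bounds jk; apply/eqP; rewrite eqn_leq hi leqNgt.
apply/negP => lt; have := next_col_gt jk.
rewrite height_row0 => [/height_gt[x [y [xA yR mxy h]]]|x xA]; last first.
  apply/negP => /corner_row. by move=> /(_ jk); lia.
have [xC|xC|xC] := ltngtP x (C i).
- by have := height_marker_lt mxy xC yR; rewrite h ltnn.
- have lt1 := ch.2 _ jk; have [] := @corner_low i.+1 x y ltac:(lia) mxy; rewrite /=; lia.
- by rewrite xC in mxy; have := corner_col (ltnW jk) mxy; have := ch.2 _ jk; lia.
Qed.

(** If both fail, the height at the old marker j+1 exceeds [rho j] and [rho j.+1]. A marker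
    southwest of it with height one less then lies right of [C j] and above [R j.+2], so it could
    replace marker j+1, against minimality. *)
Lemma next_or j : j.+2 < k -> A j = C j.+1 \/ B j.+1 = R j.+1.
Proof.
move=> jk; have jk' := ltnW jk.
have [a1 a2] := next_col_bounds jk'; have [b1 b2] := next_row_bounds jk.
have [/eqP ->|na] := boolP (A j == C j.+1); first by left.
have [/eqP ->|nb] := boolP (B j.+1 == R j.+1); first by right.
have hA : rho j < height m (C j.+1) (R j.+1).
  rewrite -[height m _ (R j.+1)](@placement_row m) //; last exact: ch.1.
  by apply: leq_trans (next_col_gt jk') _; apply: height_mono; lia.
have hB : rho j.+1 < height m (C j.+1) (R j.+1).
  rewrite -[height m (C j.+1) _](@placement_col m) //; last exact: ch.1.
  by apply: leq_trans (next_row_gt jk) _; apply: height_mono; lia.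
have /height_gt[x [y [xC yR mxy h]]] :
  (height m (C j.+1) (R j.+1)).-1 < height m (C j.+1) (R j.+1) by lia.
have x1 : C j < x.
  rewrite ltnNge leq_eqVlt; apply/negP => /predU1P[e|lt].
    rewrite e in mxy; have := corner_col (ltnW jk') mxy.
    by have := ch.2 j jk'; lia.
  by have := height_marker_lt mxy lt yR; rewrite -/(rho j); lia.
have y1 : R j.+2 < y.
  rewrite ltnNge leq_eqVlt; apply/negP => /predU1P[e|lt].
    rewrite e in mxy; have := corner_row jk mxy.
    by have := ch.2 _ jk; lia.
  by have := height_marker_lt mxy xC lt; rewrite -/(rho j.+1); lia.
have l1 := ch.2 j jk'; have l2 := ch.2 j.+1 jk.
by have [] := @corner_low j.+1 x y jk' mxy; rewrite /=; lia.
Qed.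

(* The corners where the j-th shifted marker raises the height by one. *)
Definition in_bump j a b := [&& C j < a, a <= A j, R j.+1 < b & b <= B j].

(** A larger height needs a marker of height at least [rho j], which the choice of [A j] and [B j]
    forces into the gap between markers j and j+1; [corner_gap] forbids it. *)
Lemma height_bump j a b : j.+1 < k -> in_bump j a b -> height m a b = rho j.
Proof.
move=> jk /and4P[a1 a2 b1 b2].
have ge : rho j <= height m a b by apply: height_mono; lia.
apply/eqP; rewrite eqn_leq ge andbT leqNgt; apply/negP.
move=> /height_gt[x [y [xa yb mxy e]]].
have [_ hA] := next_col_bounds jk; have [_ hB] := next_row_bounds jk.
have yR : R j.+1 < y.
  rewrite ltnNge; apply/negP => le; have := next_col_le jk (leqnn _).
  by have := @height_marker_lt m x y (A j) (R j.+1).+1 mxy ltac:(lia) le; lia.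
have xC : C j < x.
  rewrite ltnNge; apply/negP => le; have := next_row_le jk (leqnn _).
  by have := @height_marker_lt m x y (C j).+1 (B j) mxy le ltac:(lia); lia.
by apply: (corner_gap jk mxy xC _ yR); lia.
Qed.

Lemma height_nbump j a b : j.+1 < k -> C j < a -> R j.+1 < b ->
  ~~ in_bump j a b -> rho j < height m a b.
Proof.
move=> jk ca rb; rewrite /in_bump ca rb /= negb_and -!ltnNge => /orP[lt|lt].
  by apply: leq_trans (next_col_gt jk) _; apply: height_mono; lia.
by apply: leq_trans (next_row_gt jk) _; apply: height_mono; lia.
Qed.

Lemma bump_col_inj i j a b b' : i.+1 < k -> j.+1 < k ->
  in_bump i a b -> in_bump j a b' -> i = j.
Proof.
move=> ik jk /and4P[h1 h2 _ _] /and4P[h3 h4 _ _].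
have [_ hi] := next_col_bounds ik; have [_ hj] := next_col_bounds jk.
case: (ltngtP i j) => // lt.
  by have [] := chain_le ch lt ltac:(lia); lia.
by have [] := chain_le ch lt ltac:(lia); lia.
Qed.

Lemma bump_row_inj i j a a' b : i.+1 < k -> j.+1 < k ->
  in_bump i a b -> in_bump j a' b -> i = j.
Proof.
move=> ik jk /and4P[_ _ h1 h2] /and4P[_ _ h3 h4].
have [_ hi] := next_row_bounds ik; have [_ hj] := next_row_bounds jk.
case: (ltngtP i j) => // lt.
  by have [] := chain_le ch lt ltac:(lia); lia.
by have [] := chain_le ch lt ltac:(lia); lia.
Qed.

Hypothesis k2 : 1 < k.

(** The northeast corner of a bump is a skeleton marker, since the height is constant on the bump
    and grows beyond its right and its upper side. *)
Lemma next_chain : chain (skel m) k.-1 A B.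
Proof.
split=> j jk.
  have jk' : j.+1 < k by lia.
  have [a1 a2] := next_col_bounds jk'; have [b1 b2] := next_row_bounds jk'.
  have e : height m (A j) (B j) = rho j by apply: height_bump; rewrite /in_bump; lia.
  rewrite /skel e; apply/andP; split.
    by apply: leq_trans (next_col_gt jk') _; apply: height_mono.
  by apply: leq_trans (next_row_gt jk') _; apply: height_mono.
have [jk1 jk2] : j.+1 < k /\ j.+2 < k by lia.
have [] := next_col_bounds jk1; have [] := next_row_bounds jk1.
have [] := next_col_bounds jk2; have [] := next_row_bounds jk2.
lia.
Qed.

Lemma next_max C' R' : ~ chain (skel m) k.-1.+1 C' R'.
Proof.
by rewrite prednK ?(ltnW k2) // => /(chain_lift pm (ltnW k2)); apply: cc_max cc _ _.
Qed.

(** By splicing, the two chains are comparable marker by marker. Were [(C' j, R' j)] strictly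
    southwest of [(A j, B j)], comparing the lifted chain with the corner chain would place it in
    bump j together with its right neighbour, where a constant height leaves no room for a skeleton
    marker. *)
Lemma next_min C' R' : chain (skel m) k.-1 C' R' ->
  forall j, j < k.-1 -> A j <= C' j /\ B j <= R' j.
Proof.
move=> ch' j jk; have k0 : 0 < k.-1 by lia.
have sp := skel_placement pm.
have chE := chain_lift pm k0 ch'; rewrite prednK ?(ltnW k2) // in chE.
have minE := cc_min cc chE.
have jk' : j.+1 < k by lia.
have [a1 a2] := next_col_bounds jk'; have [b1 b2] := next_row_bounds jk'.
have sj := ch'.1 _ jk; have tj := next_chain.1 _ jk.
have noNW : ~ (C' j < A j /\ B j < R' j).
  by case=> lt1 lt2; apply: next_max (chain_splice ch' next_chain jk lt1 lt2).
have noSE : ~ (A j < C' j /\ R' j < B j).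
  by case=> lt1 lt2; apply: next_max (chain_splice next_chain ch' jk lt1 lt2).
have eqc : C' j = A j -> R' j = B j by move=> e; rewrite e in sj; apply: sp.1 sj tj.
have eqr : R' j = B j -> C' j = A j by move=> e; rewrite e in sj; apply: sp.2 sj tj.
suff : ~ (C' j < A j /\ R' j < B j) by lia.
case=> ltC ltR.
(* If the lift took the marker in column [C' j], minimality would give [C j.+1 <= C' j], contrary to
   [C' j < A j]. *)
have Rj : R j.+1 < R' j.
  have := minE j.+1 jk'; rewrite /lift_col /lift_row.
  case: ifP => [/= _|ld]; first by lia.
  have jk2 : j.+1 < k.-1.
    by move: ld; rewrite /lift_down /=; case: eqP => //; lia.
  by have := ch'.2 _ jk2; lia.
have Cj : C j < C' j.
  have := minE j ltac:(lia); rewrite /lift_col /lift_row.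
  case: ifP => [/andP[j0 _]|ld]; last by lia.
  by have := ch'.2 j.-1; rewrite prednK // => /(_ ltac:(lia)); lia.
have in1 : in_bump j (C' j) (R' j) by rewrite /in_bump; lia.
have in2 : in_bump j (C' j).+1 (R' j) by rewrite /in_bump; lia.
by case/andP: sj; rewrite (height_bump jk' in1) (height_bump jk' in2) ltnn.
Qed.

Lemma corner_chain_skel : corner_chain (skel m) k.-1 A B.
Proof.
split; [exact: skel_placement | | exact: next_chain | | exact: next_min].
- move=> a b s; have [x [_ mxb _]] := skel_row s; have [y [_ may _]] := skel_col s.
  rewrite (next_row0 k2) (next_col_last k2).
  by have [_ ->] := cc_bound cc mxb; have [-> _] := cc_bound cc may.
- exact: next_max.
Qed.

End Shift.

(** * Heights and skeleton of the shifted placement *)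

Section Shifted.
Variables (m : grid) (k : nat) (C R : nat -> nat).

Definition bumped a b := has (fun j => in_bump m C R j a b) (iota 0 k.-1).

Lemma bumpedP a b : reflect (exists2 j, j.+1 < k & in_bump m C R j a b) (bumped a b).
Proof. by apply: (iffP (has_iotaP _ _)) => -[j *]; exists j => //; lia. Qed.

Hypothesis cc : corner_chain m k C R.

Let pm := cc_placement cc.
Let ch := cc_chain cc.

Local Notation rho := (base_height m C R).
Local Notation A := (next_col m C R).
Local Notation B := (next_row m C R).
Local Notation M := (shifted m k C R).

Lemma shiftedP a b :
  reflect ((m a b /\ forall j, j < k -> ~ (a = C j /\ b = R j))
           \/ exists2 j, j.+1 < k & a = C j /\ b = R j.+1) (M a b).
Proof.
apply: (iffP orP) => -[].
- move=> /andP[mab /has_iotaP no]; left; split=> // j jk [ea eb]; apply: no.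
  by exists j; rewrite // ea eb !eqxx.
- by move=> /has_iotaP[j jk /andP[/eqP -> /eqP ->]]; right; exists j => //; lia.
- move=> [mab no]; left; rewrite mab; apply/has_iotaP => -[j jk /andP[/eqP e /eqP e']].
  exact: no jk _.
- move=> [j jk [-> ->]]; right; apply/has_iotaP; exists j; rewrite ?eqxx //; lia.
Qed.

Lemma nbump_base j : j.+1 < k -> ~~ bumped (C j) (R j.+1).
Proof.
move=> jk; apply/bumpedP => -[i ik /and4P[h1 h2 h3 h4]].
have [_ hA] := next_col_bounds cc ik.
have ij : i < j.
  by rewrite ltnNge; apply/negP => /(chain_le ch) /(_ (ltnW ik)); lia.
by have := chain_le ch ij; have := ch.2 j jk; lia.
Qed.

Lemma nbump_marker a b : m a b -> ~~ bumped a b.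
Proof.
move=> mab; apply/bumpedP => -[j jk /and4P[h1 h2 h3 h4]].
have [_ hA] := next_col_bounds cc jk; have [_ hB] := next_row_bounds cc jk.
apply: (corner_gap cc jk mab) => //; rewrite ltn_neqAle.
  rewrite (leq_trans h2 hA) andbT; apply/eqP => e.
  by rewrite e in mab; have := corner_col cc jk mab; lia.
rewrite (leq_trans h4 hB) andbT; apply/eqP => e.
by rewrite e in mab; have := corner_row cc (ltnW jk) mab; lia.
Qed.

Lemma nbump_marker_ne a b : m a b -> ~~ bumped a.+1 b.+1.
Proof.
move=> mab; apply/bumpedP => -[j jk bu]; have e := height_bump cc jk bu.
case/and4P: bu => h1 h2 h3 h4.
have : rho j <= height m a b by apply: height_mono; lia.
by have := height_marker mab; lia.
Qed.

Lemma height_bumped_le a b a' b' : a <= a' -> b <= b' ->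
  bumped a b -> ~~ bumped a' b' -> height m a b < height m a' b'.
Proof.
move=> aa bb /bumpedP[j jk bu] nb; rewrite (height_bump cc jk bu).
case/and4P: bu => h1 h2 h3 h4; apply: (height_nbump cc jk); try lia.
by apply: contra nb => bu; apply/bumpedP; exists j.
Qed.

(** Induction along the recursion of [height]: a new marker starts a bump, a bump makes up for each
    removed marker, and elsewhere a bump continues at constant height or ends where the height
    grows. *)
Lemma height_shifted a b : a <= C k.-1 -> b <= R 0 ->
  height M a b = height m a b + bumped a b.
Proof.
have b0l b' : bumped 0 b' = false by apply/bumpedP => -[j jk /and4P[]].
have b0r a' : bumped a' 0 = false by apply/bumpedP => -[j jk /and4P[]].
elim: a b => [|a IHa] b; first by rewrite !height0l b0l.
move=> aw; elim: b => [|b IHb] br; first by rewrite !height0r b0r.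
rewrite heightS IHa ?IHb ?IHa; try lia.
have hNE := heightS m a b.
have [/shiftedP[[mab no]|[j jk [ea eb]]]|nM] := boolP (M a b).
- rewrite (negbTE (nbump_marker mab)) (negbTE (nbump_marker_ne mab)).
  rewrite placement_ne // placement_row // placement_col //.
  by case: (bumped _ _); case: (bumped _ _); lia.
- have [lt1 lt2] := ch.2 j jk.
  have [a1 a2] := next_col_bounds cc jk; have [b1 b2] := next_row_bounds cc jk.
  have bu : in_bump m C R j a.+1 b.+1 by rewrite /in_bump; lia.
  have -> : bumped a.+1 b.+1 by apply/bumpedP; exists j.
  have -> : bumped a b = false by rewrite ea eb; apply/negbTE/nbump_base.
  have := height_bump cc jk bu; rewrite /base_height -ea -eb.
  by case: (bumped _ _); case: (bumped _ _); lia.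
- have [mab|nmab] := boolP (m a b).
    have [j jk [ea eb]] : exists2 j, j < k & a = C j /\ b = R j.
      have : has (fun j => (a == C j) && (b == R j)) (iota 0 k).
        by apply: contraNT nM => no; rewrite /shifted mab no.
      by move=> /has_iotaP[j jk /andP[/eqP ? /eqP ?]]; exists j.
    (* The first and the last marker of the chain lie in the top row and the last column, beyond the
       squares considered here. *)
    have j0 : 0 < j by rewrite lt0n; apply/eqP => e; rewrite e in eb; lia.
    have jk1 : j.+1 < k.
      rewrite ltn_neqAle jk andbT; apply/eqP => e.
      by move: aw; rewrite ea -e /= ltnn.
    have [i e] : exists i, j = i.+1 by exists j.-1; lia.
    rewrite {}e in ea eb jk jk1.
    (* By [next_or], bump i reaches the northwest corner of the removed marker or bump i+1 its
       southeast corner. *)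
    have q : bumped a b.+1 || bumped a.+1 b.
      have [a1 a2] := next_col_bounds cc jk1; have [b1 b2] := next_row_bounds cc jk1.
      have [a3 a4] := next_col_bounds cc jk; have [b3 b4] := next_row_bounds cc jk.
      case: (next_or cc jk1) => e; apply/orP; [left|right]; apply/bumpedP.
        by exists i => //; rewrite /in_bump; lia.
      by exists i.+1 => //; rewrite /in_bump; lia.
    rewrite (negbTE (nbump_marker mab)) (negbTE (nbump_marker_ne mab)).
    rewrite placement_ne // placement_row // placement_col //.
    by move: q; case: (bumped _ _); case: (bumped _ _); lia.
  rewrite (negbTE nmab) addn0 in hNE.
  have l1 := height_leSr m a b; have l2 := height_leSl m a b.
  have l3 := height_leSl m a b.+1; have l4 := height_leSr m a.+1 b.
  have s1 := @height_bumped_le a b.+1 a.+1 b.+1 (leqnSn _) (leqnn _).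
  have s2 := @height_bumped_le a.+1 b a.+1 b.+1 (leqnn _) (leqnSn _).
  have s3 := @height_bumped_le a b a.+1 b.+1 (leqnSn _) (leqnSn _).
  have [q|nq] := boolP (bumped a.+1 b.+1); last first.
    move: s1 s2 s3; rewrite (negbTE nq).
    by case: (bumped a b.+1); case: (bumped a.+1 b); case: (bumped a b) => /=; lia.
  (* A bump that does not begin at this square, which has no new marker, extends to the left or
     downwards with the same height. *)
  have {s1 s2 s3} qq :
      bumped a b.+1 && (height m a b.+1 == height m a.+1 b.+1)
      || bumped a.+1 b && (height m a.+1 b == height m a.+1 b.+1).
    case/bumpedP: q => j jk bu; rewrite (height_bump cc jk bu).
    case/and4P: bu => h1 h2 h3 h4.
    have [ca|ca] := ltnP (C j) a.
      have bu : in_bump m C R j a b.+1 by rewrite /in_bump; lia.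
      by apply/orP; left; rewrite (height_bump cc jk bu) eqxx andbT; apply/bumpedP; exists j.
    have [rb|rb] := ltnP (R j.+1) b.
      have bu : in_bump m C R j a.+1 b by rewrite /in_bump; lia.
      by apply/orP; right; rewrite (height_bump cc jk bu) eqxx andbT; apply/bumpedP; exists j.
    by case/negP: nM; apply/shiftedP; right; exists j => //; lia.
  move: qq.
  by case: (bumped a b.+1); case: (bumped a.+1 b); case: (bumped a b) => /=; lia.
Qed.


Lemma shifted_bound a b : 0 < k -> M a b -> a < C k.-1 /\ b < R 0.
Proof.
move=> k0 /shiftedP[[mab no]|[j jk [-> ->]]]; last first.
  by have := @chain_lt _ _ _ _ j k.-1 ch; have := @chain_lt _ _ _ _ 0 j.+1 ch; lia.
have [la lb] := cc_bound cc mab; rewrite !ltn_neqAle la lb !andbT.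
split; apply/eqP => e; rewrite e in mab.
  by apply: (no k.-1); [lia | split=> //; apply: (corner_col cc _ mab); lia].
by apply: (no 0) => //; split=> //; apply: (corner_row cc _ mab); lia.
Qed.

Lemma in_bump_corner j : j.+1 < k -> in_bump m C R j (A j) (B j).
Proof.
move=> jk; rewrite /in_bump.
by have := next_col_bounds cc jk; have := next_row_bounds cc jk; lia.
Qed.

Lemma nbump_corner j : j.+2 < k -> ~~ bumped (A j) (B j.+1).
Proof.
move=> jk; apply/bumpedP => -[i ik bu].
have e1 := bump_col_inj cc ik (ltnW jk) bu (in_bump_corner (ltnW jk)).
have e2 := bump_row_inj cc ik jk bu (in_bump_corner jk).
by lia.
Qed.

Lemma nbump_skel a b : skel m a b -> (forall j, j < k.-1 -> ~ (a = A j /\ b = B j)) ->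
  ~~ bumped a b.
Proof.
case/andP=> s1 s2 no; apply/bumpedP => -[j jk bu].
move: s1 s2; rewrite (height_bump cc jk bu) => s1 s2.
apply: (no j); first by lia.
case/and4P: bu => h1 h2 h3 h4; split; apply/eqP; rewrite eqn_leq.
  rewrite h2 leqNgt; apply/negP => lt.
  by move: s1; rewrite (@height_bump m k C R cc j) ?ltnn // /in_bump; lia.
rewrite h4 leqNgt; apply/negP => lt.
by move: s2; rewrite (@height_bump m k C R cc j) ?ltnn // /in_bump; lia.
Qed.

(** By [next_or], bump j+1 lies to the right of this corner or bump j above it. A bumped side rises
    because of the bump, the other one because the old height grows beyond [A j] or [B j.+1]. *)
Lemma skel_shifted_corner j : j.+2 < k -> skel M (A j) (B j.+1).
Proof.
move=> jk; have jk1 := ltnW jk.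
have [a1 a2] := next_col_bounds cc jk1; have [b1 b2] := next_row_bounds cc jk1.
have [a3 a4] := next_col_bounds cc jk; have [b3 b4] := next_row_bounds cc jk.
have aw : C j.+1 < C k.-1 by have := @chain_lt _ _ _ _ j.+1 k.-1 ch; lia.
have br : R j.+1 < R 0 by have := @chain_lt _ _ _ _ 0 j.+1 ch; lia.
rewrite /skel !height_shifted; try lia.
rewrite (negbTE (nbump_corner jk)) addn0.
have l1 := height_leSl m (A j) (B j.+1); have l2 := height_leSr m (A j) (B j.+1).
have bSE : A j = C j.+1 -> bumped (A j).+1 (B j.+1).
  by move=> e; apply/bumpedP; exists j.+1 => //; rewrite e /in_bump; lia.
have bNW : B j.+1 = R j.+1 -> bumped (A j) (B j.+1).+1.
  by move=> e; apply/bumpedP; exists j => //; rewrite e /in_bump; lia.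
have [e1|n1] := eqVneq (A j) (C j.+1); have [e2|n2] := eqVneq (B j.+1) (R j.+1).
- by rewrite bSE // bNW //; lia.
- rewrite bSE //; apply/andP; split; first by lia.
  have hSE : height m (A j).+1 (B j.+1) = rho j.+1.
    by apply: (height_bump cc jk); rewrite e1 /in_bump; lia.
  have := next_row_gt cc jk; rewrite -e1 height_col0; first by lia.
  by move=> y yB; apply/negP; rewrite e1 => /(corner_col cc jk1); lia.
- rewrite bNW //; apply/andP; split; last by lia.
  have hNW : height m (A j) (B j.+1).+1 = rho j.
    by apply: (height_bump cc jk1); rewrite e2 /in_bump; lia.
  have := next_col_gt cc jk1; rewrite -e2 height_row0; first by lia.
  by move=> x xA; apply/negP; rewrite e2 => /(corner_row cc jk1); lia.
- by case: (next_or cc jk) => e; move: n1 n2; rewrite e eqxx.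
Qed.

(** Shifting commutes with taking the skeleton. Through [height_shifted] the question is which of
    the three corners SW, SE, NW of the square are bumped. *)
Lemma skel_shifted a b : 1 < k ->
  skel M a b = shifted (skel m) k.-1 A B a b.
Proof.
move=> k2; apply/idP/idP => [s|].
  have [[x [xa Mxb _]] [y [yb May _]]] := (skel_row s, skel_col s).
  have [aw _] := shifted_bound (ltnW k2) May; have [_ br] := shifted_bound (ltnW k2) Mxb.
  move: s => {x xa Mxb y yb May}; rewrite /skel !height_shifted; try lia.
  case/andP=> sSE sNW.
  have qSW : ~~ bumped a b.
    apply/bumpedP => -[j jk bu]; move: sSE.
    have -> : bumped a b by apply/bumpedP; exists j.
    case: (boolP (bumped a.+1 b)) => [/bumpedP[i ik bu']|_].
      have e := bump_row_inj cc ik jk bu' bu; rewrite e in bu'.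
      by rewrite (height_bump cc jk bu) (height_bump cc jk bu') ltnn.
    by have := height_stepl m a b; lia.
  rewrite (negbTE qSW) addn0 in sSE sNW.
  have inSW j : j.+1 < k -> C j < a -> a <= A j -> R j.+1 < b -> b <= B j -> False.
    move=> jk *; case/negP: qSW; apply/bumpedP; exists j => //.
    by rewrite /in_bump; lia.
  suff H : (exists2 j, j.+2 < k & a = A j /\ b = B j.+1)
        \/ (~~ bumped a.+1 b /\ ~~ bumped a b.+1).
    rewrite /shifted; case: H => [[j jk [-> ->]]|[n1 n2]]; apply/orP.
      by right; apply/has_iotaP; exists j; rewrite ?eqxx //; lia.
    left; apply/andP; split.
      by move: sSE sNW; rewrite (negbTE n1) (negbTE n2) !addn0 /skel => -> ->.
    apply/has_iotaP => -[j jk /andP[/eqP ea /eqP eb]]; case/negP: qSW.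
    by apply/bumpedP; exists j; [lia | rewrite ea eb in_bump_corner //; lia].
  have [/bumpedP[j jk bu]|n1] := boolP (bumped a.+1 b).
    left; have hSE := height_bump cc jk bu; case/and4P: bu => h1 h2 h3 h4.
    have [a1 a2] := next_col_bounds cc jk; have [b1 b2] := next_row_bounds cc jk.
    (* The southwest corner is not bumped, so bump j begins exactly at this column. *)
    have ea : a = C j.
      by have [lt|] := ltnP (C j) a; [exfalso; apply: (inSW j); lia | lia].
    have hSW : height m a b = rho j.
      rewrite -hSE ea height_col0 // => y yb'; apply/negP.
      by move=> /(corner_col cc (ltnW jk)); lia.
    have [/bumpedP[i ik /and4P[g1 g2 g3 g4]]|n2] := boolP (bumped a b.+1).
      have [a3 a4] := next_col_bounds cc ik; have [b3 b4] := next_row_bounds cc ik.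
      have eb : b = R i.+1.
        by have [lt|] := ltnP (R i.+1) b; [exfalso; apply: (inSW i); lia | lia].
      have eij : j = i.+1.
        case: (ltngtP j i.+1) => // lt.
          by have := @chain_le _ _ _ _ j i ch ltac:(lia); lia.
        by have := @chain_lt _ _ _ _ i.+1 j ch lt; lia.
      rewrite eij in ea jk b2 h4; exists i => //; lia.
    rewrite (negbTE n2) addn0 hSW in sNW.
    have eb : b = B j.
      apply/eqP; rewrite eqn_leq h4 leqNgt; apply/negP => lt.
      have : height m a.+1 b.+1 = rho j.
        by apply: (height_bump cc jk); rewrite /in_bump; lia.
      by have := height_leSl m a b.+1; lia.
    (* With [B j = R j] the square would hold the marker j itself, and the height does not grow
       across the row left of a marker. *)
    have nb : B j <> R j.
      move=> e; have := sNW; rewrite placement_row ?hSW ?ltnn //.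
      by rewrite ea eb e; apply: ch.1; lia.
    have j0 : 0 < j.
      by rewrite lt0n; apply/eqP => e; apply: nb; rewrite e; apply: next_row0 cc k2.
    have [i e] : exists i, j = i.+1 by exists j.-1; lia.
    by rewrite e in ea eb nb jk; exists i => //; case: (next_or cc jk) => //; rewrite ea.
  have [/bumpedP[j jk bu]|n2] := boolP (bumped a b.+1); last by right.
  left; have hNW := height_bump cc jk bu; case/and4P: bu => h1 h2 h3 h4.
  have [a1 a2] := next_col_bounds cc jk; have [b1 b2] := next_row_bounds cc jk.
  have eb : b = R j.+1.
    by have [lt|] := ltnP (R j.+1) b; [exfalso; apply: (inSW j); lia | lia].
  have hSW : height m a b = rho j.
    rewrite -hNW eb height_row0 // => x xa'; apply/negP.
    by move=> /(corner_row cc jk); lia.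
  rewrite (negbTE n1) addn0 hSW in sSE.
  have ea : a = A j.
    apply/eqP; rewrite eqn_leq h2 leqNgt; apply/negP => lt.
    have : height m a.+1 b.+1 = rho j.
      by apply: (height_bump cc jk); rewrite /in_bump; lia.
    by have := height_leSr m a.+1 b; lia.
  have na : A j <> C j.+1.
    move=> e; have := sSE; rewrite placement_col ?hSW ?ltnn //.
    by rewrite eb ea e; apply: ch.1; lia.
  have jk2 : j.+2 < k.
    rewrite ltn_neqAle jk andbT; apply/eqP => e; apply: na.
    by have := next_col_last cc k2; rewrite -e.
  by exists j => //; case: (next_or cc jk2) => //; rewrite eb.
case/orP=> [/andP[s /has_iotaP no]|/has_iotaP[j jk /andP[/eqP -> /eqP ->]]]; last first.
  by apply: skel_shifted_corner; lia.
have nb : ~~ bumped a b.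
  apply: nbump_skel => // j jk [ea eb]; apply: no; exists j => //.
  by rewrite ea eb !eqxx.
have cs := corner_chain_skel cc k2.
have [aw br] : a < C k.-1 /\ b < R 0.
  rewrite -(next_row0 cc k2) -(next_col_last cc k2).
  have [la lb] := cc_bound cs s; rewrite !ltn_neqAle la lb !andbT.
  split; apply/eqP => e; apply: no; rewrite e in s.
    exists k.-2; first by lia.
    by rewrite e eqxx (corner_col cs _ s) ?eqxx //; lia.
  exists 0; first by lia.
  by rewrite e eqxx (corner_row cs _ s) ?eqxx //; lia.
by move: s; rewrite /skel !height_shifted; lia.
Qed.

End Shifted.

(** * Comparison along the top and right sides of the rectangle *)

Lemma level_empty (m : grid) w r i :
  (forall a b, a < w -> b < r -> ~~ m a b) ->
  forall a b, a <= w -> b <= r -> height (level m i) a b = 0.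
Proof.
elim: i m => [|i IH] m no a b aw br.
  apply/eqP; rewrite -leqn0 leqNgt; apply/negP => /height_gt[x [y [xa yb mxy _]]].
  by have /negP := no x y ltac:(lia) ltac:(lia); apply.
rewrite levelSr; apply: IH => // {aw br} a' b' aw br; apply/negP => /skel_row[x [xa mxb _]].
by have /negP := no x b' ltac:(lia) ltac:(lia); apply.
Qed.

(** Reflection in the diagonal exchanges columns and rows and reverses the order of a decreasing
    chain. *)
Definition rev_index k (f : nat -> nat) j := f (k.-1 - j).

Lemma chain_tr (m : grid) k C R : chain m k C R ->
  chain (transpose m) k (rev_index k R) (rev_index k C).
Proof.
case=> pts step; split=> j jk; rewrite /rev_index; first by apply: pts; lia.
have e : k.-1 - j = (k.-1 - j.+1).+1 by lia.
by rewrite e; have := step (k.-1 - j.+1); lia.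
Qed.

Lemma corner_chain_tr (m : grid) k C R : 0 < k -> corner_chain m k C R ->
  corner_chain (transpose m) k (rev_index k R) (rev_index k C).
Proof.
move=> k0 cc; split.
- exact/placement_tr/(cc_placement cc).
- move=> a b /(cc_bound cc); rewrite /rev_index subnn subn0; lia.
- exact/chain_tr/(cc_chain cc).
- by move=> C' R' /chain_tr; apply: cc_max cc _ _.
- move=> C' R' /chain_tr ch j jk.
  have := cc_min cc ch (j := k.-1 - j) ltac:(lia).
  by rewrite /rev_index subKn; lia.
Qed.

Lemma shifted_tr (m : grid) k C R a b :
  shifted (transpose m) k (rev_index k R) (rev_index k C) b a = shifted m k C R a b.
Proof.
rewrite /shifted; congr ((_ && ~~ _) || _); apply/has_iotaP/has_iotaP => -[j jk e].
- by exists (k.-1 - j); [lia | move: e; rewrite /rev_index andbC].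
- exists (k.-1 - j); first by lia.
  by rewrite /rev_index subKn 1?andbC //; lia.
- exists (k.-2 - j); first by lia.
  move: e; rewrite /rev_index andbC.
  have -> : k.-1 - j = (k.-2 - j).+1 by lia.
  by have -> : k.-1 - j.+1 = k.-2 - j by lia.
- exists (k.-2 - j); first by lia.
  rewrite /rev_index andbC.
  have -> : k.-1 - (k.-2 - j) = j.+1 by lia.
  by have -> : k.-1 - (k.-2 - j).+1 = j by lia.
Qed.

Section Border.
Variables (m : grid) (k : nat) (C R : nat -> nat).
Hypotheses (cc : corner_chain m k C R) (k2 : 1 < k).

Let pm := cc_placement cc.
Let ch := cc_chain cc.
Let cs := corner_chain_skel cc k2.

(** Row [R 0] has its marker in column [C 0] and, as [B 0 = R 0], its skeleton marker in column
    [A 0]. So the height rises across this row for [C 0 < a <= A 0], which is where the first bump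
    meets its lower side. *)
Lemma height_top_shifted a : a <= C k.-1 ->
  height m a (R 0).+1 = height (shifted m k C R) a (R 0).
Proof.
move=> aw; rewrite height_row_edge // (height_shifted cc) //; congr (_ + nat_of_bool _).
have k0 : 0 < k := ltnW k2.
have [a1 a2] := next_col_bounds cc k2.
apply/andP/bumpedP => [[/row_markerP[x xa mx] /row_markerP no]|[j jk /and4P[h1 h2 h3 h4]]].
  have xE := corner_row cc k0 mx; exists 0 => //.
  have [lt|le] := leqP a (next_col m C R 0).
    have := next_row_bounds cc k2.
    by rewrite /in_bump (next_row0 cc k2); lia.
  case: no; exists (next_col m C R 0) => //.
  by rewrite -(next_row0 cc k2); apply: cs.(cc_chain).1; lia.
have [b1 b2] := next_row_bounds cc jk.
have j0 : j = 0.
  apply/eqP; rewrite -leqn0 leqNgt; apply/negP => lt.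
  by have := @chain_lt _ _ _ _ 0 j ch lt; lia.
rewrite {}j0 in h1 h2 h3 h4 jk b1 b2; split.
  by apply/row_markerP; exists (C 0) => //; apply: ch.1.
apply/row_markerP => -[x xa s].
have : x = next_col m C R 0.
  by apply: (corner_row cs); [lia | rewrite (next_row0 cc k2)].
lia.
Qed.

End Border.

Lemma height_right_shifted (m : grid) k C R b :
  corner_chain m k C R -> 1 < k -> b <= R 0 ->
  height m (C k.-1).+1 b = height (shifted m k C R) (C k.-1) b.
Proof.
move=> cc k2 br; have cct := corner_chain_tr (ltnW k2) cc.
have := @height_top_shifted _ _ _ _ cct k2 b.
rewrite (height_tr m) /rev_index subn0 subnn => -> //.
rewrite -(height_tr (shifted m k C R)).
by apply: (@height_agree _ _ b (C k.-1)) => // x y _ _; apply: shifted_tr.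
Qed.

(* The skeletons of m and of the shifted m are again related by a shift, along
   a chain with one marker less, so all entries are compared by induction. *)
Lemma level_shifted (m m' : grid) k C R : 0 < k -> corner_chain m k C R ->
  (forall a b, m' a b = shifted m k C R a b) ->
  [/\ forall i a, a <= C k.-1 ->
        height (level m i) a (R 0).+1 = height (level m' i) a (R 0),
      forall i b, b <= R 0 ->
        height (level m i) (C k.-1).+1 b = height (level m' i) (C k.-1) b
    & level m k.-1 (C k.-1) (R 0)].
Proof.
move=> k0; elim: k k0 m m' C R => // k IH _ m m' C R cc em'.
have agr a b : height m' a b = height (shifted m k.+1 C R) a b.
  by apply: (@height_agree _ _ a b) => // x y _ _; apply: em'.
case: (posnP k) => [k0|k0].
  (* A single marker is a chain of length 1, so minimality and the bound leave only [(C 0, R 0)],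
     and the shifted placement is empty. *)
  subst k; have pt a b : m a b -> a = C 0 /\ b = R 0.
    move=> mab; have [la lb] := cc_bound cc mab.
    have ch1 : chain m 1 (fun=> a) (fun=> b) by [].
    by have := cc_min cc ch1 (ltn0Sn 0); move: la; rewrite /=; lia.
  have m'0 a b : ~~ m' a b.
    rewrite em'; apply/shiftedP => -[[/pt[ea eb] no]|[j]]; last by lia.
    exact: (no 0).
  rewrite -[1.-1]/0; split=> [i a aw|i b br|]; last exact: (cc_chain cc).1.
    rewrite (@level_empty m (C 0) (R 0).+1) ?(@level_empty m' (C 0) (R 0)) //.
    by move=> x y xC _; apply/negP => /pt; lia.
  rewrite (@level_empty m (C 0).+1 (R 0)) ?(@level_empty m' (C 0) (R 0)) //.
  by move=> x y _ yR; apply/negP => /pt; lia.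
have k2 : 1 < k.+1 by lia.
have cs := corner_chain_skel cc k2.
have es a b : skel m' a b = shifted (skel m) k (next_col m C R) (next_row m C R) a b.
  rewrite -[k in RHS]/(k.+1.-1) -(skel_shifted cc) //.
  by apply: (@skel_agree _ _ a.+1 b.+1) => // x y _ _; apply: em'.
have [top right corner] := IH k0 _ _ _ _ cs es.
have eC : next_col m C R k.-1 = C k := next_col_last cc k2.
have eR : next_row m C R 0 = R 0 := next_row0 cc k2.
rewrite eC eR in top right corner; split=> [i a aw|i b br|].
- case: i => [|i]; last by rewrite !levelSr; apply: top.
  by rewrite agr; apply: (height_top_shifted cc k2).
- case: i => [|i]; last by rewrite !levelSr; apply: right.
  by rewrite agr; apply: (height_right_shifted cc k2).
- by rewrite -[k.+1.-1]/k -{1}(prednK k0) levelSr.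
Qed.

(** * Labels of growth diagrams *)

Lemma eq_from_nth0 (s t : seq nat) : 0 \notin s -> 0 \notin t ->
  (forall i, nth 0 s i = nth 0 t i) -> s = t.
Proof.
move=> s0 t0 e; apply: (eq_from_nth (x0 := 0)) => // .
have le (u v : seq nat) : 0 \notin u -> (forall i, nth 0 u i = nth 0 v i) -> size u <= size v.
  move=> u0 e'; rewrite leqNgt; apply/negP => lt; case/negP: u0.
  by rewrite -[X in X \in _](@nth_default _ 0 v (size v)) // -e' mem_nth.
by apply/eqP; rewrite eqn_leq !le.
Qed.

Lemma nth_notin0 (s : seq nat) i : 0 \notin s -> (nth 0 s i == 0) = (size s <= i).
Proof.
move=> s0; apply/eqP/idP => [e|]; last exact: nth_default.
by rewrite leqNgt; apply: contra s0 => lt; rewrite -e mem_nth.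
Qed.

Lemma notin0_incr_nth (s : seq nat) i : 0 \notin s -> i <= size s -> 0 \notin incr_nth s i.
Proof.
move=> s0 le; apply/(nthP 0) => -[j]; rewrite size_incr_nth nth_incr_nth => lt.
move/eqP; rewrite addn_eq0 nth_notin0 // => /andP[].
by case: (i =P j) => // ij _; move: lt; case: ifP; lia.
Qed.

Lemma nth_partition_union (s t : seq nat) i :
  nth 0 (partition_union s t) i = maxn (nth 0 s i) (nth 0 t i).
Proof.
rewrite /partition_union; have [lt|ge] := ltnP i (maxn (size s) (size t)).
  by rewrite nth_mkseq.
by rewrite !nth_default ?size_mkseq //; lia.
Qed.

Lemma notin0_partition_union (s t : seq nat) : 0 \notin s -> 0 \notin t ->
  0 \notin partition_union s t.
Proof.
move=> s0 t0; apply/(nthP 0) => -[j]; rewrite size_mkseq nth_partition_union => lt /eqP.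
have := nth_notin0 j s0; have := nth_notin0 j t0; lia.
Qed.

Lemma count_notin0 (s : seq nat) : 0 \notin s -> count (fun m => m != 0) s = size s.
Proof. by move=> s0; apply/eqP; rewrite -all_count; apply/allP => x; apply: contraTneq => ->. Qed.

Lemma level_tr (m : grid) i a b : level (transpose m) i b a = level m i a b.
Proof.
elim: i a b => [//|i IH] a b.
rewrite /= -[RHS]skel_tr; apply: (@skel_agree _ _ b.+1 a.+1) => // x y _ _; exact: IH.
Qed.

Lemma height_level_tr (m : grid) i a b :
  height (level (transpose m) i) b a = height (level m i) a b.
Proof.
rewrite -(height_tr (level m i)).
by apply: (@height_agree _ _ b a) => // x y _ _; apply: level_tr.
Qed.

Lemma level_row0 (m : grid) i a b : placement m -> (forall x, x < a -> ~~ m x b) ->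
  height (level m i) a b.+1 = height (level m i) a b.
Proof.
move=> pm no; rewrite (height_row_edge _ _ (level_placement i pm)).
case: (boolP (row_marker (level m i) a b)) => [|_]; last by rewrite addn0.
move=> /(@row_marker_level m 0 i _ _ (leq0n i)) /row_markerP[x /no/negP n' l].
by case: (n' l).
Qed.

Lemma level_col0 (m : grid) i a b : placement m -> (forall y, y < b -> ~~ m a y) ->
  height (level m i) a.+1 b = height (level m i) a b.
Proof.
by move=> pm no; rewrite -!(height_level_tr m) level_row0 //; apply: placement_tr.
Qed.

Section LocalRules.
Variables (m : grid).
Hypothesis pm : placement m.

(** An edge adds at most one box: level i grows only if it has a marker in the row so far and level
    i+1 has none, and the levels with a marker there form an initial segment. *)
Lemma row_edge_unique i j a b : i != j ->
  height (level m i) a b < height (level m i) a b.+1 ->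
  height (level m j) a b.+1 = height (level m j) a b.
Proof.
have pl l := level_placement l pm.
rewrite !height_row_edge // => ij lt; have {lt} : row_marker (level m i) a b &&
    ~~ row_marker (level m i.+1) a b by move: lt; case: (_ && _) => //; rewrite addn0 ltnn.
move=> /andP[ri nri]; case: (ltngtP i j) ij => // lt _.
  by rewrite (negbTE (contra (@row_marker_level m _ _ a b lt) nri)) addn0.
by rewrite (@row_marker_level m j.+1 i a b lt ri) andbF addn0.
Qed.

Lemma level_row i a b : level m i.+1 a b ->
  height (level m i) a b.+1 = (height (level m i) a b).+1.
Proof.
move=> l; have /andP[_] : skel (level m i) a b := l.
by have := height_stepr (level m i) a b; lia.
Qed.

Lemma level_left i a b : level m i a b -> forall x, x < a -> ~~ level m i x b.
Proof.
move=> l x xa; apply/negP => l'.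
by have := (level_placement i pm).2 _ _ _ l l'; lia.
Qed.

(** A marker of a higher level has markers of all lower levels strictly to its left in the same
    row. *)
Lemma level_unique i j a b : level m i a b -> level m j a b -> i = j.
Proof.
have H i' j' : i' < j' -> level m i' a b -> level m j' a b -> False.
  move=> lt l l'; have : row_marker (level m i'.+1) a.+1 b.
    by apply: row_marker_level lt _; apply/row_markerP; exists a.
  case/row_markerP=> x xa /skel_row[y [yx ly _]].
  by have /negP[] := level_left l (leq_trans yx xa : y < a).
by move=> l l'; case: (ltngtP i j) => // lt; case: (H _ _ lt).
Qed.

Lemma level0_row i a b : m a b ->
  height (level m i) a b.+1 = height (level m i) a b.
Proof.
by move=> mab; apply: level_row0 => // x xa; apply: (@level_left 0 _ _ mab).
Qed.

Lemma height_levelS i a b : height (level m i) a.+1 b.+1 =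
  if level m i a b then (height (level m i) a b).+1
  else maxn (height (level m i) a b.+1) (height (level m i) a.+1 b).
Proof.
case: ifP => l; first by rewrite placement_ne //; apply: level_placement.
by rewrite heightS l; have := height_leSl (level m i) a b; have := height_leSr (level m i) a b;
   have := height_leSr (level m i) a.+1 b; lia.
Qed.

End LocalRules.

(** Excluding zeros makes the list unique, trailing zeros being invisible to [nth]. *)
Definition labels (m : grid) a b (s : seq nat) :=
  0 \notin s /\ forall i, nth 0 s i = height (level m i) a b.

Lemma labels_inj m m' a b a' b' s t : labels m a b s -> labels m' a' b' t ->
  (forall i, height (level m i) a b = height (level m' i) a' b') -> s = t.
Proof.
by move=> [s0 es] [t0 et] e; apply: eq_from_nth0 => // i; rewrite es et.
Qed.

Section LocalLabels.
Variables (m : grid).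
Hypothesis pm : placement m.

Lemma level_edges i a b : level m i a b -> forall j,
  height (level m j) a b.+1 = height (level m j) a b + (i == j.+1) /\
  height (level m j) a.+1 b = height (level m j) a b + (i == j.+1).
Proof.
have pt := placement_tr pm.
case: i => [|i] l j.
  rewrite !addn0 level0_row //; split=> //.
  by rewrite -!(height_level_tr m) level0_row.
have lr := level_row l.
have lc : height (level m i) a.+1 b = (height (level m i) a b).+1.
  by rewrite -!(height_level_tr m) level_row // level_tr.
have [<-|ne] := eqVneq i j; first by rewrite eqxx addn1.
rewrite eqSS (negbTE ne) addn0; split.
  by apply: (row_edge_unique pm ne); rewrite lr.
rewrite -!(height_level_tr m); apply: (row_edge_unique pt ne).
by rewrite !(height_level_tr m) lc.
Qed.

Lemma find_edge a b sw nw i : labels m a b sw -> labels m a b.+1 nw ->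
  level m i.+1 a b ->
  find (fun i => nth 0 sw i != nth 0 nw i) (iota 0 (size nw)) = i.
Proof.
move=> [sw0 esw] [nw0 enw] l; have ed j := (level_edges l j).1.
have [le lo hi] := find_iota (fun i => nth 0 sw i != nth 0 nw i) (size nw).
move: le lo hi; move: (find _ _) => f le lo hi.
have lt : i < size nw by rewrite ltnNge -nth_notin0 // enw ed eqxx addn1.
have fi : f <= i.
  rewrite leqNgt; apply/negP => /lo; rewrite esw enw ed eqxx; lia.
by have := hi (leq_ltn_trans fi lt); rewrite esw enw ed eqSS; case: eqP => //; lia.
Qed.

(** The rules are [height_levelS] for all levels at once: rule 2 applies at the markers of positive
    level, rule 3 adds a box at those of level 0, and rule 1 only meets squares without a marker of
    any level. *)
Lemma northeast_labels a b sw nw se :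
  labels m a b sw -> labels m a b.+1 nw -> labels m a.+1 b se ->
  labels m a.+1 b.+1 (northeast rule2 (m a b) sw nw se).
Proof.
move=> lsw lnw lse; have [[sw0 esw] [nw0 enw] [se0 ese]] := And3 lsw lnw lse.
have eqe i : level m i a b -> nw = se.
  move=> l; apply: eq_from_nth0 => // j; rewrite enw ese.
  by have [-> ->] := level_edges l j.
rewrite /northeast; case: eqVneq => [e|ne] /=; last first.
  split; first exact: notin0_partition_union.
  move=> i; rewrite nth_partition_union height_levelS // enw ese.
  by case: ifP => // /eqe e; rewrite e eqxx in ne.
have hEE i : height (level m i) a b.+1 = height (level m i) a.+1 b.
  by rewrite -enw -ese e.
case: eqVneq => [e'|ne] /=; last first.
  have [i hi] : exists i, height (level m i) a b < height (level m i) a b.+1.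
    have : has (fun i => nth 0 sw i != nth 0 nw i) (iota 0 (maxn (size sw) (size nw))).
      apply: contraNT ne => /hasPn no; apply/eqP/eq_from_nth0 => // i.
      have [lt|ge] := ltnP i (maxn (size sw) (size nw)).
        by apply/eqP; move: (no i); rewrite negbK; apply; rewrite mem_iota.
      by rewrite !nth_default //; lia.
    case/has_iotaP=> i _; rewrite esw enw => nei; exists i.
    by have := height_leSr (level m i) a b; lia.
  have l : level m i.+1 a b by rewrite /= /skel -hEE hi.
  rewrite /rule2 (find_edge lsw lnw l).
  split; first by apply: notin0_incr_nth; rewrite // ltnNge -nth_notin0 // enw; lia.
  move=> j; rewrite nth_incr_nth enw height_levelS // -hEE maxnn.
  have [<-|nej] := eqVneq i.+1 j.
    have := (level_edges l i.+1).1; rewrite l; case: eqP; lia.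
  by case: ifP => // l'; rewrite (level_unique pm l l') eqxx in nej.
have eSW i : height (level m i) a b.+1 = height (level m i) a b.
  by rewrite -enw -esw e'.
have nol i : level m i.+1 a b = false.
  by apply/negP => l; have /andP[_] : skel (level m i) a b := l; rewrite eSW ltnn.
case: (boolP (m a b)) => mab; split=> //.
- exact: notin0_incr_nth.
- move=> [|i]; rewrite nth_incr_nth esw height_levelS //.
    by rewrite /= mab.
  by rewrite nol -hEE eSW maxnn.
- move=> [|i]; rewrite esw height_levelS //.
    by rewrite (negbTE mab : level m 0 a b = false) -hEE eSW maxnn.
  by rewrite nol -hEE eSW maxnn.
Qed.

End LocalLabels.

Lemma northeast_rule2k k mk sw nw se :
  count (fun m => m != 0) (northeast rule2 mk sw nw se) != k ->
  northeast (rule2k k) mk sw nw se = northeast rule2 mk sw nw se.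
Proof.
rewrite /northeast; case: (nw == se) => //=; case: (sw == nw) => //= /negbTE ne.
by rewrite /rule2k ne.
Qed.

Section GrowthLevels.
Variables (n : nat) (P : {set square n}).
Let m : grid := has_square P.
Hypothesis pm : placement m.

Lemma growth_labels a b : labels m a b (growth rule2 P a b).
Proof.
elim: a b => [|a IHa] b.
  by rewrite growth0l; split=> // i; rewrite nth_nil height0l.
elim: b => [|b IHb].
  by rewrite growth0r; split=> // i; rewrite nth_nil height0r.
by rewrite growthS; apply: northeast_labels.
Qed.

(** Heights are monotone, so no corner southwest of this one has a k-th entry and the modification
    of rule 2 is never triggered. *)
Lemma growth_rule2k k a b : 0 < k -> height (level m k.-1) a b = 0 ->
  growth (rule2k k) P a b = growth rule2 P a b.
Proof.
move=> k0; elim: a b => [|a IHa] b; first by rewrite !growth0l.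
elim: b => [|b IHb] h; first by rewrite !growth0r.
have lab := growth_labels a.+1 b.+1.
have hz x y : x <= a.+1 -> y <= b.+1 -> height (level m k.-1) x y = 0.
  by move=> xa yb; apply/eqP; rewrite -leqn0 -h height_mono.
rewrite !growthS IHa ?IHa ?IHb ?hz //; apply: northeast_rule2k.
rewrite -growthS count_notin0 ?lab.1 //; apply/eqP => e.
have := nth_notin0 k.-1 lab.1; rewrite lab.2 h e eqxx; lia.
Qed.

End GrowthLevels.

(** * Occurrences *)

Lemma lexi_antisym (s t : seq nat) : size s = size t ->
  ((s : seqlexi nat) <= (t : seqlexi nat))%O ->
  (forall i, nth 0 t i <= nth 0 s i) -> s = t.
Proof.
elim: s t => [|x s IH] [|y t] //= [sz]; rewrite lexi_cons => /andP[xy st] le.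
have yx : y <= x := le 0.
have e : x = y by apply/eqP; rewrite eqn_leq yx andbT; exact: xy.
rewrite e; congr cons; apply: IH => // [|i]; last exact: le i.+1.
by apply: implyP st _; exact: yx.
Qed.

Section Squares.
Variable n : nat.
Implicit Types (F P : {set square n}).

Lemma has_squareP P a b :
  reflect (exists2 x, x \in P & x.1 = a :> nat /\ x.2 = b :> nat) (has_square P a b).
Proof.
apply: (iffP existsP) => -[x]; first by case/and3P=> xP /eqP ? /eqP ?; exists x.
by move=> xP [? ?]; exists x; rewrite xP /=; apply/andP; split; apply/eqP.
Qed.

Lemma has_square_in P (x : square n) : has_square P x.1 x.2 = (x \in P).
Proof.
apply/has_squareP/idP => [[y yP [/val_inj e1 /val_inj e2]]|]; last by exists x.
by rewrite [x]surjective_pairing -e1 -e2 -surjective_pairing.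
Qed.

Lemma rook_placementP F P :
  rook_placement F P <-> P \subset F /\ placement (has_square P).
Proof.
split=> [[sub i1 i2]|[sub [p1 p2]]].
  split=> //; split=> [a b b'|a a' b] /has_squareP[x xP [e1 e2]] /has_squareP[y yP [e3 e4]].
    by rewrite -e2 -e4 (i1 x y) //; apply: val_inj; rewrite /= e1 e3.
  by rewrite -e1 -e3 (i2 x y) //; apply: val_inj; rewrite /= e2 e4.
split=> // x y xP yP e; rewrite -has_square_in in xP; rewrite -has_square_in in yP.
  rewrite -e in yP; rewrite [x]surjective_pairing [y]surjective_pairing -e; congr pair.
  by apply: val_inj; apply: p1 xP yP.
rewrite -e in yP; rewrite [x]surjective_pairing [y]surjective_pairing -e; congr pair.
by apply: val_inj; apply: p2 xP yP.
Qed.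

Lemma chain_occurrence k F P C R c : chain (has_square P) k C R ->
  ferrers F -> c \in F -> C k.-1 <= c.1 -> R 0 <= c.2 ->
  exists t : k.-tuple (square n), occurrence F P t /\ rows t = mkseq R k.
Proof.
move=> ch ferF cF Cc Rc.
pose g j := odflt c [pick x in P | (x.1 == C j :> nat) && (x.2 == R j :> nat)].
have gP j : j < k -> [/\ g j \in P, (g j).1 = C j :> nat & (g j).2 = R j :> nat].
  move=> jk; rewrite /g; case: pickP => [x /and3P[xP /eqP ? /eqP ?] //|no].
  have /has_squareP[x xP [e1 e2]] := ch.1 j jk.
  by have := no x; rewrite xP e1 e2 !eqxx.
exists (Tuple (introT eqP (size_mkseq g k))); split; last first.
  rewrite /rows /= /mkseq -map_comp; apply/eq_in_map => j; rewrite mem_iota => jk.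
  by case: (gP j jk).
apply/and3P; split.
- by apply/allP => x /mapP[j]; rewrite mem_iota => /= jk ->; case: (gP j jk).
- apply/(sortedP c) => j /=; rewrite size_mkseq => jk; rewrite !nth_mkseq //; last exact: ltnW.
  have [_ -> ->] := gP j (ltnW jk); have [_ -> ->] := gP _ jk.
  by have [-> ->] := ch.2 _ jk.
- apply/existsP; exists c; rewrite ferF //=.
  apply/allP => x /mapP[j]; rewrite mem_iota => /= jk ->.
  have [_ e1 e2] := gP j jk; rewrite inE e1 e2.
  have := @chain_le _ _ _ _ j k.-1 ch; have := @chain_le _ _ _ _ 0 j ch; lia.
Qed.

Lemma occurrence_chain k F P (s : k.-tuple (square n)) x0 : occurrence F P s ->
  chain (has_square P) k (fun j => (nth x0 s j).1) (fun j => (nth x0 s j).2).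
Proof.
case/and3P=> /allP sP /(sortedP x0) srt _; split=> j jk.
  by rewrite has_square_in; apply: sP; rewrite mem_nth // size_tuple.
by apply/andP; apply: srt; rewrite size_tuple.
Qed.

(** A marker of level k-1 southwest of the corner lifts to k markers whose last column and top row
    keep them in the rectangle of a square of F, which is an occurrence. *)
Lemma level_avoid k F P a b : 0 < k -> placement (has_square P) -> ferrers F ->
  ~~ has_occurrence k F P -> corner_of F a b ->
  height (level (has_square P) k.-1) a b = 0.
Proof.
move=> k0 pm ferF no /existsP[c /and3P[cF ca cb]].
apply/eqP; rewrite -leqn0 leqNgt; apply/negP => /height_gt[x [y [xa yb l _]]].
have [C [R [ch eC eR]]] := chain_of_level pm l; rewrite prednK // in ch.
have [||t [tP _]] := chain_occurrence ch ferF cF; [rewrite eC; lia | rewrite eR; lia |].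
by case/negP: no; apply/existsP; exists t.
Qed.

Lemma border_seqk_avoid k F P : 0 < k -> rook_placement F P -> ferrers F ->
  ~~ has_occurrence k F P -> border_seqk k P F = border_seq P F.
Proof.
move=> k0 /rook_placementP[_ pm] ferF no; apply/eq_in_map => -[a b].
rewrite mem_filter => /andP[/andP[/= cor _] _].
by apply: growth_rule2k => //; apply: level_avoid cor.
Qed.

Lemma nth_shift_rows (s : seq (square n)) x0 j : j < size s ->
  nth x0 (shift_rows s) j =
  ((nth x0 s j).1, (nth x0 s (if j.+1 < size s then j.+1 else 0)).2).
Proof.
case: x0 => x1 x2; case: s => //= x s js; rewrite /shift_rows nth_zip; last first.
  by rewrite size_rot !size_map.
congr pair; first by rewrite (nth_map (x1, x2)).
rewrite [map snd _]/= rot1_cons nth_rcons size_map ltnS.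
have [lt|ge] := ltnP j (size s); first by rewrite (nth_map (x1, x2)).
have -> : j = size s by lia.
by rewrite eqxx.
Qed.

Lemma size_shift_rows (s : seq (square n)) : size (shift_rows s) = size s.
Proof. by rewrite /shift_rows size1_zip ?size_rot size_map // size_map. Qed.

End Squares.

(** * Invariance under phi *)

Section PhiStep.
Variables (k n : nat) (F P : {set square n}) (s : k.-tuple (square n)).
Hypotheses (k2 : 1 < k) (ferF : ferrers F) (rookP : rook_placement F P).
Hypothesis occ_s : occurrence F P s.
Hypothesis min_s : forall t : k.-tuple (square n), occurrence F P t -> (rows s <= rows t)%O.
Variable c : square n.
Hypothesis cF : c \in F.
Hypothesis s_in_c : forall x, x \in tval s -> x \in rectangle c.

Let m : grid := has_square P.
Let pm : placement m. Proof. by case/rook_placementP: rookP. Qed.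
Let k0 : 0 < k. Proof. exact: ltnW. Qed.

Definition occ_col j : nat := (nth c s j).1.
Definition occ_row j : nat := (nth c s j).2.
Local Notation C := occ_col.
Local Notation R := occ_row.
Local Notation w := (C k.-1).
Local Notation r := (R 0).

Lemma occ_chain : chain m k C R.
Proof. exact: (occurrence_chain c occ_s). Qed.
Let ch := occ_chain.

Lemma occ_bound j : j < k -> C j <= c.1 /\ R j <= c.2.
Proof.
move=> jk; have := @s_in_c (nth c s j); rewrite mem_nth ?size_tuple // inE.
by move=> /(_ isT) /andP.
Qed.

(** The bound in [corner_chain] concerns all markers, so those outside the rectangle spanned by the
    smallest occurrence are dropped. *)
Definition boxed : grid := fun a b => [&& m a b, a <= w & b <= r].

Lemma boxed_chain C' R' l : 0 < l -> chain m l C' R' -> C' l.-1 <= w -> R' 0 <= r ->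
  chain boxed l C' R'.
Proof.
move=> l0 ch' Cw Rr; split=> [j jl|]; last exact: ch'.2.
have := ch'.1 j jl; rewrite /boxed => ->.
by have := @chain_le _ _ _ _ j l.-1 ch'; have := @chain_le _ _ _ _ 0 j ch'; lia.
Qed.

Lemma chain_boxed C' R' l : chain boxed l C' R' -> chain m l C' R'.
Proof. by case=> pts step; split=> // j /pts /and3P[]. Qed.

Lemma rows_occ : rows s = mkseq R k.
Proof.
apply: (@eq_from_nth _ 0); rewrite /rows size_map ?size_mkseq size_tuple // => j jk.
by rewrite (nth_map c) ?size_tuple // nth_mkseq.
Qed.

Lemma boxed_min C' R' : chain boxed k C' R' ->
  ((mkseq R k : seqlexi nat) <= (mkseq R' k : seqlexi nat))%O.
Proof.
move=> ch'; have /and3P[_ Cw _] := ch'.1 k.-1 ltac:(lia).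
have /and3P[_ _ Rr] := ch'.1 0 k0.
have [b1 _] := @occ_bound k.-1 ltac:(lia); have [_ b2] := occ_bound k0.
have [||t [occ_t e]] := chain_occurrence (chain_boxed ch') ferF cF; try lia.
by have := min_s occ_t; rewrite e rows_occ.
Qed.

(** The last k markers of a longer chain would form an occurrence with a lower top row, hence a
    lexicographically smaller one. *)
Lemma boxed_max C' R' : ~ chain boxed k.+1 C' R'.
Proof.
move=> ch'; have ch1 : chain boxed k (fun j => C' j.+1) (fun j => R' j.+1).
  by split=> j jk; [apply: ch'.1 | apply: ch'.2].
have [_ lt] := ch'.2 0 (k0 : 1 < k.+1).
have /and3P[_ _ le] := ch'.1 0 (ltn0Sn k).
have := boxed_min ch1; rewrite -(prednK k0) /mkseq /= lexi_cons => /andP[le' _].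
by have := leq_ltn_trans (le' : r <= R' 1) (leq_trans lt le); rewrite ltnn.
Qed.

(* The pointwise minimum of two maximal chains is again a chain, so the
   lexicographically smallest one is the smallest one pointwise. *)
Lemma boxed_southwest C' R' : chain boxed k C' R' ->
  forall j, j < k -> C j <= C' j /\ R j <= R' j.
Proof.
move=> ch'; have chb : chain boxed k C R by apply: boxed_chain.
have chm := chain_boxed ch'.
have cmp j : j < k -> C j <= C' j /\ R j <= R' j \/ C' j <= C j /\ R' j <= R j.
  move=> jk.
  have n1 : ~ (C j < C' j /\ R' j < R j).
    by case=> l1 l2; apply: boxed_max (chain_splice chb ch' jk l1 l2).
  have n2 : ~ (C' j < C j /\ R j < R' j).
    by case=> l1 l2; apply: boxed_max (chain_splice ch' chb jk l1 l2).
  lia.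
have chM : chain boxed k (fun j => minn (C j) (C' j)) (fun j => minn (R j) (R' j)).
  split=> j jk.
    case: (cmp j jk) => -[l1 l2].
      by rewrite (minn_idPl l1) (minn_idPl l2); apply: chb.1.
    by rewrite (minn_idPr l1) (minn_idPr l2); apply: ch'.1.
  by have := chb.2 j jk; have := ch'.2 j jk; lia.
have e : mkseq R k = mkseq (fun j => minn (R j) (R' j)) k.
  apply: lexi_antisym (boxed_min chM) _; first by rewrite !size_mkseq.
  move=> i; have [ik|ik] := ltnP i k; last by rewrite !nth_default ?size_mkseq.
  by rewrite !nth_mkseq // geq_minl.
have leR j : j < k -> R j <= R' j.
  by move=> jk; have := congr1 (fun t => nth 0 t j) e; rewrite !nth_mkseq //; lia.
move=> j jk; split; last exact: leR; have lR := leR j jk.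
(* In the remaining case the rows agree, so both chains use the same marker. *)
case: (cmp j jk) => -[l1 l2] //; have eR : R j = R' j by lia.
have := ch.1 j jk; rewrite eR => mj.
by have := pm.2 _ _ _ mj (chm.1 j jk); lia.
Qed.

Lemma boxed_corner_chain : corner_chain boxed k C R.
Proof.
split; [| | exact: boxed_chain | exact: boxed_max | exact: boxed_southwest].
  by split=> a b b' /and3P[l _ _] /and3P[l' _ _]; [apply: pm.1 l l' | apply: pm.2 l l'].
by move=> a b /and3P[].
Qed.
Let cc := boxed_corner_chain.

Definition next_index j := if j.+1 < k then j.+1 else 0.

Definition phi_set := (P :\: [set x in s]) :|: [set x in shift_rows s].
Let mp : grid := has_square phi_set.

Lemma mem_occ x : reflect (exists2 j, j < k & x = nth c s j) (x \in tval s).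
Proof.
by apply: (iffP (nthP c)) => -[j]; rewrite ?size_tuple => jk e; exists j;
  rewrite ?size_tuple.
Qed.

Lemma mem_shift x :
  reflect (exists2 j, j < k & x = ((nth c s j).1, (nth c s (next_index j)).2))
    (x \in shift_rows s).
Proof.
apply: (iffP (nthP c)) => -[j]; rewrite size_shift_rows size_tuple => jk e; exists j => //.
  by rewrite -e nth_shift_rows size_tuple.
by rewrite e nth_shift_rows size_tuple.
Qed.

Lemma phi_setP a b :
  reflect ((m a b /\ forall j, j < k -> ~ (a = C j /\ b = R j))
           \/ exists2 j, j < k & a = C j /\ b = R (next_index j)) (mp a b).
Proof.
apply: (iffP (has_squareP _ _ _)) => [[x]|].
  rewrite !inE => /orP[/andP[xs xP] [e1 e2]|/mem_shift[j jk ->] [e1 e2]]; last first.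
    by right; exists j.
  left; split; first by apply/has_squareP; exists x.
  move=> j jk [ea eb]; case/mem_occ: xs; exists j => //.
  by rewrite [x]surjective_pairing [RHS]surjective_pairing; congr pair;
    apply: val_inj; rewrite /= ?e1 ?e2.
case=> [[/has_squareP[x xP [e1 e2]] no]|[j jk [-> ->]]]; last first.
  exists ((nth c s j).1, (nth c s (next_index j)).2) => //.
  by rewrite !inE; apply/orP; right; apply/mem_shift; exists j.
exists x => //; rewrite !inE xP andbT; apply/orP; left; apply/mem_occ => -[j jk e].
by apply: (no j jk); rewrite -e1 -e2 e.
Qed.

Lemma next_index_lt j : next_index j < k.
Proof. by rewrite /next_index; case: ifP. Qed.

Lemma next_index_inj i j : i < k -> j < k -> next_index i = next_index j -> i = j.
Proof. by rewrite /next_index; case: ifP; case: ifP; lia. Qed.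

Lemma phi_placement : placement mp.
Proof.
split=> [a b b'|a a' b] /phi_setP[[l no]|[i ik [ea eb]]] /phi_setP[[l' no']|[j jk [ea' eb']]].
- exact: pm.1 l l'.
- rewrite ea' in l no; case: (no j jk); split=> //.
  exact: pm.1 l (ch.1 j jk).
- rewrite ea in l' no'; case: (no' i ik); split=> //.
  exact: pm.1 l' (ch.1 i ik).
- have e : i = j by apply: (chain_col_inj ch) => //; rewrite -ea -ea'.
  by rewrite eb eb' e.
- exact: pm.2 l l'.
- rewrite eb' in l no; case: (no _ (next_index_lt j)); split=> //.
  exact: pm.2 l (ch.1 _ (next_index_lt j)).
- rewrite eb in l' no'; case: (no' _ (next_index_lt i)); split=> //.
  exact: pm.2 l' (ch.1 _ (next_index_lt i)).
- have e : i = j.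
    apply: next_index_inj => //; apply: (chain_row_inj ch); rewrite ?next_index_lt //.
    by rewrite -eb -eb'.
  by rewrite ea ea' e.
Qed.

Lemma phi_rook : rook_placement F phi_set.
Proof.
apply/rook_placementP; split; last exact: phi_placement.
have [sub _] := (rook_placementP F P).1 rookP.
apply/subsetP => x; rewrite !inE => /orP[/andP[_ /(subsetP sub)] //|/mem_shift[j jk ->]].
apply: (subsetP (ferF cF)); rewrite inE /=.
by rewrite (occ_bound jk).1 (occ_bound (next_index_lt j)).2.
Qed.

Lemma phi_outside a b : w < a \/ r < b -> mp a b = m a b.
Proof.
move=> out; have bnd j : j < k -> C j <= w /\ R j <= r.
  by move=> jk; have := @chain_le _ _ _ _ j k.-1 ch; have := @chain_le _ _ _ _ 0 j ch; lia.
apply/phi_setP/idP => [[[] //|[j jk [ea eb]]]|l].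
  by have := bnd j jk; have := bnd _ (next_index_lt j); lia.
by left; split=> // j jk [ea eb]; have := bnd j jk; lia.
Qed.

Lemma phi_inside a b : a <= w -> b <= r -> (a != w) || (b != r) ->
  mp a b = shifted boxed k C R a b.
Proof.
move=> aw br ne; apply/phi_setP/shiftedP; rewrite /boxed aw br andbT.
  case=> [[l no]|[j jk [ea eb]]]; [left | right].
    by rewrite l.
  move: ea eb; rewrite /next_index; case: ifP => lt ea eb; first by exists j.
  have e : j = k.-1 by lia.
  by move: ne; rewrite ea eb e !eqxx.
case=> [[/andP[l _] no]|[j jk [ea eb]]]; [left | right] => //.
by exists j; [lia | rewrite /next_index jk].
Qed.

Lemma phi_corner : mp w r.
Proof.
apply/phi_setP; right; exists k.-1; first by lia.
by rewrite /next_index ifF //; lia.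
Qed.

Let key := level_shifted k0 cc (fun a b => erefl (shifted boxed k C R a b)).

Lemma level_boxed i a b : a <= w.+1 -> b <= r.+1 ->
  height (level m i) a b = height (level boxed i) a b.
Proof.
apply: level_agree => x y; rewrite !ltnS /boxed => -> ->.
by rewrite /= andbT.
Qed.

Lemma phi_row_empty x : x < w -> ~~ mp x r.
Proof.
move=> xw; apply/negP; rewrite phi_inside //; try lia.
by move=> /(shifted_bound cc k0); lia.
Qed.

Lemma phi_col_empty y : y < r -> ~~ mp w y.
Proof.
move=> yr; apply/negP; rewrite phi_inside //; try lia.
by move=> /(shifted_bound cc k0); lia.
Qed.

Lemma level_phi i a b : a <= w -> b <= r ->
  height (level mp i) a b = height (level (shifted boxed k C R) i) a b.
Proof.
apply: level_agree => x y xw yr; apply: phi_inside; lia.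
Qed.

(** After [phi] the marker of row r is in column w, so left of it the row is empty and both of its
    sides carry the same heights. *)
Lemma level_top i a : a <= w ->
  height (level m i) a r.+1 = height (level mp i) a r /\
  height (level mp i) a r.+1 = height (level mp i) a r.
Proof.
move=> aw; have [top _ _] := key; split.
  by rewrite level_boxed ?top ?level_phi //; lia.
rewrite level_row0 //; first exact: phi_placement.
by move=> x xa; apply: phi_row_empty; lia.
Qed.

Lemma level_right i b : b <= r ->
  height (level m i) w.+1 b = height (level mp i) w b /\
  height (level mp i) w.+1 b = height (level mp i) w b.
Proof.
move=> br; have [_ right _] := key; split.
  by rewrite level_boxed ?right ?level_phi //; lia.
rewrite level_col0 //; first exact: phi_placement.
by move=> y yb; apply: phi_col_empty; lia.
Qed.

Lemma level_corner : level m k.-1 w r.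
Proof.
have up i : skel (level boxed i) w r -> skel (level m i) w r.
  by rewrite /skel !level_boxed.
have kk : k.-1 = k.-2.+1 by lia.
have [_ _] := key; have := up k.-2.
by rewrite -[skel (level boxed _)]/(level boxed k.-2.+1) -[skel (level m _)]/(level m k.-2.+1) -kk.
Qed.

(** A marker of level k-1 lifts to a chain of length k in the rectangle, whose last column and top
    row are at least w and r by minimality. *)
Lemma level_zero a b : a <= w.+1 -> b <= r.+1 -> a <= w \/ b <= r ->
  height (level m k.-1) a b = 0.
Proof.
move=> aw br out; apply/eqP; rewrite -leqn0 leqNgt; apply/negP.
move=> /height_gt[x [y [xa yb l _]]].
have [C' [R' [ch' eC eR]]] := chain_of_level pm l; rewrite prednK // in ch'.
have chb : chain boxed k C' R' by apply: boxed_chain => //; lia.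
have [_ le1] := cc_min cc chb k0.
have [le2 _] := cc_min cc chb (j := k.-1) ltac:(lia).
lia.
Qed.

Lemma level_phi_zero a b : a <= w -> b <= r -> height (level mp k.-1) a b = 0.
Proof.
move=> aw br; apply/eqP; rewrite -leqn0.
rewrite -(@level_zero w r.+1) //; last by left.
by rewrite (level_top k.-1 (leqnn w)).1 height_mono.
Qed.

(** * Growth labels around the rectangle *)

Local Notation gk := (growth (rule2k k)).

Let gkP a b : a <= w.+1 -> b <= r.+1 -> a <= w \/ b <= r -> labels m a b (gk P a b).
Proof.
by move=> *; rewrite growth_rule2k ?level_zero //; apply: growth_labels.
Qed.

Let gkphi a b : height (level mp k.-1) a b = 0 -> labels mp a b (gk phi_set a b).
Proof.
move=> z; rewrite growth_rule2k //; last exact: phi_placement.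
by apply: growth_labels; apply: phi_placement.
Qed.

Lemma growth_top a : a <= w -> gk P a r.+1 = gk phi_set a r.+1.
Proof.
move=> aw; have l := @level_top _ a aw.
apply: (labels_inj (@gkP a r.+1 _ _ _) (@gkphi a r.+1 _)); try lia.
  by rewrite (l k.-1).2 level_phi_zero.
by move=> i; rewrite (l i).1 (l i).2.
Qed.

Lemma growth_right b : b <= r -> gk P w.+1 b = gk phi_set w.+1 b.
Proof.
move=> br; have l := @level_right _ b br.
apply: (labels_inj (@gkP w.+1 b _ _ _) (@gkphi w.+1 b _)); try lia.
  by rewrite (l k.-1).2 level_phi_zero.
by move=> i; rewrite (l i).1 (l i).2.
Qed.

(* At the corner, both algorithms add the new box to the first entry: GDA_k for
   P because rule 2 would create a k-th entry, for phi P because of its marker. *)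
Lemma growth_corner : gk P w.+1 r.+1 = gk phi_set w.+1 r.+1.
Proof.
have lt := @level_top _ w (leqnn w); have lr := @level_right _ r (leqnn r).
have zSW : height (level m k.-1) w r = 0 by apply: level_zero; lia.
have l := level_corner; set nu := gk P w r.+1.
have lnu : labels m w r.+1 nu by apply: gkP; lia.
have lsw : labels m w r (gk P w r) by apply: gkP; lia.
have se : gk P w.+1 r = nu.
  apply: (labels_inj (@gkP w.+1 r _ _ _) lnu); try lia.
  by move=> i; rewrite (lr i).1 (lt i).1.
have phi0 : gk phi_set w r = nu.
  apply: labels_inj (gkphi _) lnu _; first exact: level_phi_zero.
  by move=> i; rewrite (lt i).1.
rewrite !growthS -(growth_top (leqnn w)) -(growth_right (leqnn r)) se phi0 -/nu.
have -> : has_square phi_set w r by exact: phi_corner.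
rewrite /northeast eqxx /=.
have kk : k.-1 = k.-2.+1 by lia.
have h1 : height (level m k.-2) w r < height (level m k.-2) w r.+1.
  have l2 : level m k.-2.+1 w r by rewrite -kk.
  by rewrite (level_row l2).
have nsw : gk P w r != nu.
  by apply/eqP => e; move: h1; rewrite -lsw.2 -lnu.2 e ltnn.
rewrite nsw.
have lne : labels m w.+1 r.+1 (rule2 (gk P w r) nu).
  have lse : labels m w.+1 r nu by rewrite -se; apply: gkP; lia.
  by have := northeast_labels pm lsw lnu lse; rewrite /northeast eqxx /= nsw.
(* The entry at position k-1 vanishes before the corner, and the one at position k-2 is positive
   because the square is a marker of level k-1. *)
have sz : size nu = k.-1.
  apply/eqP; rewrite eqn_leq -nth_notin0 ?lnu.1 // lnu.2.
  rewrite level_zero //=; try lia.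
  rewrite kk ltnNge -nth_notin0 ?lnu.1 // lnu.2; lia.
have nu1 : 0 \notin rcons nu 1 by rewrite mem_rcons inE /= lnu.1.
rewrite /rule2k; have -> : rule2 (gk P w r) nu = rcons nu 1.
  apply: eq_from_nth0 => // [|i]; first exact: lne.1.
  rewrite lne.2 nth_rcons sz height_levelS // -(lnu.2 i).
  have -> : height (level m i) w.+1 r = nth 0 nu i by rewrite lnu.2 (lr i).1 (lt i).1.
  rewrite maxnn; have [li|nl] := boolP (level m i w r).
    by rewrite (level_unique pm li l) ltnn eqxx zSW.
  case: ltngtP => [//|ge|e]; last by rewrite e l in nl.
  by rewrite nth_default // sz ltnW.
rewrite /= count_notin0 //.
by rewrite size_rcons sz prednK // eqxx -cats1 take_size_cat.
Qed.

(** Agreement on the top and right sides of the rectangle spreads by the local rules, since the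
    markers beyond are unchanged. *)
Lemma growth_outside a b : w < a \/ r < b -> gk P a b = gk phi_set a b.
Proof.
elim: a b => [|a IHa] b out; first by rewrite !growth0l.
elim: b out => [|b IHb] out; first by rewrite !growth0r.
have [/andP[aw br]|nin] := boolP ((a <= w) && (b <= r)).
  have [ea|na] := eqVneq a w; have [eb|nb] := eqVneq b r; try lia.
  - by rewrite ea eb growth_corner.
  - by rewrite ea growth_right //; lia.
  - by rewrite eb growth_top //; lia.
have out' : w < a \/ r < b by move: nin; rewrite negb_and -!ltnNge => /orP.
rewrite !growthS -/(m a b) -/(mp a b) phi_outside //.
by rewrite !IHa ?IHb //; lia.
Qed.

Lemma border_seqk_phi : border_seqk k phi_set F = border_seqk k P F.
Proof.
apply/eq_in_map => -[a b]; rewrite mem_filter => /andP[/andP[/= _ nF] _].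
rewrite growth_outside //; case: (ltnP w a) => aw; first by left.
case: (ltnP r b) => br; first by right.
(* The square northeast of a border corner is not in F, whereas every square of the rectangle is. *)
case/negP: nF.
have [C1 _] := @occ_bound k.-1 ltac:(lia); have [_ R1] := occ_bound k0.
have an : a < n by have := ltn_ord c.1; lia.
have bn : b < n by have := ltn_ord c.2; lia.
apply/has_squareP; exists (Ordinal an, Ordinal bn) => //.
by apply: (subsetP (ferF cF)); rewrite inE /= (leq_trans aw C1) (leq_trans br R1).
Qed.

End PhiStep.

Lemma phi_border (k n : nat) (F P : {set square n}) :
  1 < k -> ferrers F -> rook_placement F P ->
  rook_placement F (phi k F P) /\ border_seqk k (phi k F P) F = border_seqk k P F.
Proof.
move=> k2 ferF rP; rewrite /phi /smallest_occurrence; case: pickP => // s.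
case/andP=> occ_s /forallP min_s.
have {}min_s (t : k.-tuple (square n)) : occurrence F P t -> (rows s <= rows t)%O.
  by apply: implyP.
have /and3P[_ _ /existsP[c /andP[cF /allP s_in_c]]] := occ_s.
have {}cF : c \in F by apply: (subsetP cF); rewrite inE !leqnn.
split; first exact: (phi_rook k2 ferF rP occ_s cF s_in_c).
exact: (border_seqk_phi k2 ferF rP occ_s min_s cF s_in_c).
Qed.

Theorem mainTheorem1 (k n : nat) (F P : {set square n}) :
  2 <= k -> ferrers F -> rook_placement F P ->
  border_seqk k P F = border_seq (phi_star k F P) F.
Proof.
move=> k2 ferF rP; have avoid := phi_star_avoids F P k2.
have [rS <-] : rook_placement F (phi_star k F P) /\
    border_seqk k (phi_star k F P) F = border_seqk k P F.
  (* Each application of [phi] keeps a rook placement and its [GDA_k] border. *)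
  rewrite /phi_star; elim: (weight P) => [//|i [rQ eQ]] /=.
  by have [? ->] := phi_border k2 ferF rQ.
by apply: border_seqk_avoid => //; apply: ltnW.
Qed.
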